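(* Let $\kappa$ be an uncountable cardinal. For every real $t$ with $0<t<1$, the compact spaces $B(\kappa)$, $B^+(\kappa)$, $B^{1/2}(\kappa)$, $B(\kappa,-t,t)$ and $B(\kappa,0,t)$ are mutually homeomorphic.
   Context: For a set $\kappa$, $B(\kappa)=\{x\in[-1,1]^\kappa:\sum_{i\in\kappa}|x_i|\le 1\}$ with the topology inherited from the product topology, and $B^+(\kappa)=B(\kappa)\cap[0,1]^\kappa$. For functions $a,b:\kappa\to[-1,1]$ with $a(i)<b(i)$ for all $i$, $B(\kappa,a,b)=\{x\in\mathbb{R}^\kappa:\sum_{i\in\kappa}|x_i|\le 1,\ a(i)\le x_i\le b(i)\text{ for all }i\in\kappa\}$, also with the topology inherited from the product topology. A real number used in place of $a$ or $b$ denotes the corresponding constant function on $\kappa$. The half ball $B^{1/2}(\kappa)$ is $B(\kappa,a,b)$ where $b$ is constantly $1$ and $a$ is equal to $-1$ at every point of $\kappa$ except at one fixed point, where it is equal to $0$; that is, $B^{1/2}(\kappa)$ consists of the elements of $B(\kappa)$ having one fixed coordinate nonnegative. *)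

(* Defs.v *)
From HB Require Import structures.
From mathcomp Require Import all_boot all_order all_algebra.
From mathcomp Require Import all_classical all_reals all_analysis.
Set Implicit Arguments.
Unset Strict Implicit.
Unset Printing Implicit Defensive.
Import Order.TTheory GRing.Theory Num.Theory.
Import numFieldNormedType.Exports.
Local Open Scope classical_set_scope.
Local Open Scope ring_scope.

(* The spaces below are sets of points of [{ptws K -> R}], the power [R^K] with
   the product topology; as types they carry the subspace topology, which is
   the initial topology for [set_val]. *)

(* [\esum] is the supremum of the finite partial sums, in [\bar R]. *)
Definition l1_le1 (R : realType) (K : choiceType) (x : K -> R) : Prop :=
  (\esum_(i in [set: K]) `|x i|%:E <= 1%:E)%E.

Definition Bfull (R : realType) (K : choiceType) : set {ptws K -> R} :=
  [set x | (forall i, -1 <= x i <= 1) /\ l1_le1 x].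

Definition Bplus (R : realType) (K : choiceType) : set {ptws K -> R} :=
  @Bfull R K `&` [set x | forall i, 0 <= x i <= 1].

Definition Bbox (R : realType) (K : choiceType) (a b : K -> R) :
    set {ptws K -> R} :=
  [set x | l1_le1 x /\ forall i, a i <= x i <= b i].

Definition Bhalf (R : realType) (K : choiceType) (i0 : K) :
    set {ptws K -> R} :=
  Bbox (fun i => if i == i0 then 0 else -1) (fun=> 1).

Definition homeomorphic (X Y : topologicalType) : Prop :=
  exists (f : X -> Y) (g : Y -> X),
    [/\ continuous f, continuous g, cancel f g & cancel g f].

(* Main.v *)
Require Import Defs.
From HB Require Import structures.
From mathcomp Require Import all_boot all_order all_algebra.
From mathcomp Require Import all_classical all_reals all_analysis.
From mathcomp Require Import ring lra.

(* If [K] is split into blocks and each block is mapped by a pointwise continuous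
   bijection that preserves the sum of the [|x_i|] over the block, then the whole
   ball is mapped homeomorphically, the total mass being preserved. Write
   [L_t], [P], [A_t] for a coordinate in [-t, t], [0, 1], [0, t], and let [+]
   denote mass-additive sums. Three mass-preserving homeomorphisms (on mass at most
   1) suffice.
   - [P + L_t = P + P]: on each level both sides are segments.
   - [P^m = A_t^m] if [1 < m t]: on each level both sides are convex bodies with a
     common centre, so rescale radially.
   - [P + E^nat = E^nat] with [E = L_t^m] and [1 < m t]: see below.
   An infinite [K] is in bijection with [K * C] for every countable nonempty [C];
   hence [L_t^K = (E^nat)^K = (P + E^nat)^K = (P + L_t)^K = P^K], and
   [A_t^K = (A_t^m)^K = P^K]. The half ball is one block [P + E^nat] next to
   ordinary coordinates.

   For the third map use [x_i |x_i|^(-1/2)] as coordinates, so that mass becomes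
   the sum of squares. The boundary hyperplane of [P] has to be absorbed by
   infinitely many coordinates. A carry [z_n >= - k_n], initially the coordinate in
   [P] with [k_0 = 0], is combined with the component [y_n] of the [n]-th copy of
   [E] along its diagonal, and yields the new component [w_n] and the next carry
   [z_(n+1)] with [w_n^2 + z_(n+1)^2 = z_n^2 + y_n^2]. The step is a rotation by 45
   degrees preceded by a map that turns the forbidden half-plane [z < - k_n] into a
   forbidden quadrant; after the rotation this quadrant is the region below a graph
   [- k_(n+1)], where [k_(n+1)] depends only on [k_n] and [w_n]. The carry tends to
   0, so mass is preserved in the limit. The outputs determine the orbit: either
   [k_n] grows, the steps become linear and contract backwards, or [k_n] tends to 0
   and then so does [z_n + k_n], which is nondecreasing, so [z_n = - k_n].
   When the non-diagonal part of a copy of [E] is large (which happens only finitely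
   often) the bounds of [E] interfere, and the rotation angle is moved to 90 degrees,
   where the step just passes the carry on. *)

Set Implicit Arguments.
Unset Strict Implicit.
Unset Printing Implicit Defensive.
Import Order.TTheory GRing.Theory Num.Theory.
Import numFieldNormedType.Exports.
Local Open Scope classical_set_scope.
Local Open Scope ring_scope.

(** * Homeomorphisms and pointwise topology *)

Lemma homeomorphic_refl (X : topologicalType) : homeomorphic X X.
Proof. by exists id, id; split => // x. Qed.

Lemma homeomorphic_sym (X Y : topologicalType) :
  homeomorphic X Y -> homeomorphic Y X.
Proof. by move=> [f [g [fc gc fg gf]]]; exists g, f. Qed.

Lemma homeomorphic_trans (X Y Z : topologicalType) :
  homeomorphic X Y -> homeomorphic Y Z -> homeomorphic X Z.
Proof.
move=> [f [g [fc gc fg gf]]] [f' [g' [f'c g'c fg' gf']]].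
exists (f' \o f), (g \o g'); split.
- by move=> x; apply: continuous_comp; [exact: fc|exact: f'c].
- by move=> x; apply: continuous_comp; [exact: g'c|exact: gc].
- exact: can_comp.
- exact: can_comp.
Qed.

Lemma compact_set_type (X : topologicalType) (A : set X) :
  compact A -> compact [set: set_type A].
Proof.
move=> cA F PF _.
have PG : ProperFilter (set_val @ F) by exact: fmap_proper_filter.
have GA : (set_val @ F) A.
  apply: (@filterS _ F _ setT) => [x _|]; [exact: set_valP|exact: filterT].
have [a [Aa Fa]] := cA _ PG GA.
exists (SigSub (mem_set Aa)); split => // B C FB [_ [[V oV <-] /= Va VC]].
have FB' : (set_val @ F) (set_val @` B).
  by apply: (@filterS _ F _ B) => // x Bx; exists x.
have [_ [[b Bb <-] Vb]] := Fa _ _ FB' (open_nbhs_nbhs (conj oV Va)).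
by exists b; split => //; exact: VC.
Qed.

Lemma hausdorff_set_type (X : topologicalType) (A : set X) :
  hausdorff_space X -> hausdorff_space (set_type A).
Proof.
move=> hX p q pq; apply/val_inj; apply: hX => U V Up Vq.
have cv : continuous (set_val : set_type A -> X) by exact: initial_continuous.
by have [r [Ur Vr]] := pq _ _ (cv p _ Up) (cv q _ Vq); exists (val r).
Qed.

Lemma compact_bij_homeomorphic (X Y : topologicalType) (f : X -> Y) :
  compact [set: X] -> hausdorff_space Y -> continuous f -> bijective f ->
  homeomorphic X Y.
Proof.
move=> cX hY fc [g fg gf]; exists f, g; split => //.
apply/continuous_closedP => C cC.
have -> : g @^-1` C = f @` C.
  by apply/seteqP; split=> [y Cy|_ [x Cx <-]]; [exists (g y)|rewrite /= fg].
apply: compact_closed => //; apply: continuous_compact.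
  exact/continuous_subspaceT/fc.
exact: (subclosed_compact cC cX).
Qed.

(** Compactness makes the inverse continuous, so the maps below only have to be shown continuous in
    one direction and bijective. *)
Lemma homeomorphic_set_bij (X Y : topologicalType) (A : set X) (B : set Y)
    (f : X -> Y) :
  hausdorff_space Y -> compact A -> continuous f -> set_bij A B f ->
  homeomorphic (set_type A) (set_type B).
Proof.
move=> hY cA fc [fAB finj fsurj].
have fAB' (x : set_type A) : f (val x) \in B.
  by apply/mem_set/fAB; exact: set_valP.
pose h (x : set_type A) : set_type B := SigSub (fAB' x).
apply: (@compact_bij_homeomorphic _ _ h).
- exact: compact_set_type.
- exact: hausdorff_set_type.
- apply/continuousP => _ [V oV <-]; exists (f @^-1` V) => //.
  by apply: open_comp oV => x _; exact: fc.
- rewrite -setTT_bijective; suff : set_bij setT setT h by [].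
  split => //.
  + move=> x y _ _ hxy; apply/val_inj/finj; [exact: valP|exact: valP|].
    exact: (congr1 val hxy).
  + move=> y _; have [x Ax fx] := fsurj (val y) (set_valP y).
    by exists (SigSub (mem_set Ax)) => //; apply/val_inj.
Qed.

Section pointwise.
Context (R : realType).

Lemma hausdorff_ptws (J : eqType) : hausdorff_space {ptws J -> R}.
Proof. apply: hausdorff_product => _; exact: Rhausdorff. Qed.

Lemma eval_continuous (J : eqType) (j : J) :
  continuous (fun x : {ptws J -> R} => x j).
Proof. exact: (@proj_continuous J (fun=> R) j). Qed.

Lemma ptws_cvg (X : Type) (F : set_system X) (J : eqType)
    (f : X -> {ptws J -> R}) (l : {ptws J -> R}) : Filter F ->
  (forall j, f x j @[x --> F] --> l j) -> f x @[x --> F] --> l.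
Proof.
move=> FF fl; apply/cvg_sup => j; apply/cvg_image.
  by apply/seteqP; split => // r _; exists (fun=> r).
move=> U nU; have {}nU : nbhs (l j) U by exact: nU.
exists [set y | U (y j)]; first exact: fl nU.
by apply/seteqP; split => [_ [y Uy <-] //|r Ur]; exists (fun=> r).
Qed.

Lemma ptws_continuous (X : topologicalType) (J : eqType)
    (F : X -> {ptws J -> R}) :
  (forall j, continuous (fun x => F x j)) -> continuous F.
Proof. by move=> Fc x; apply: ptws_cvg => j; exact: Fc. Qed.

End pointwise.

(** * Continuity at a point of real-valued expressions *)

Section continuity.
Context (R : realType) (T : topologicalType) (x : T).
Implicit Types f g : T -> R.

Lemma cont_cst (c : R) : continuous_at x (fun=> c).
Proof. exact: cvg_cst. Qed.

Lemma contD f g : continuous_at x f -> continuous_at x g ->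
  continuous_at x (fun y => f y + g y).
Proof. exact: cvgD. Qed.

Lemma contN f : continuous_at x f -> continuous_at x (fun y => - f y).
Proof. exact: cvgN. Qed.

Lemma contM f g : continuous_at x f -> continuous_at x g ->
  continuous_at x (fun y => f y * g y).
Proof. exact: cvgM. Qed.

Lemma contV f : f x != 0 -> continuous_at x f ->
  continuous_at x (fun y => (f y)^-1).
Proof. exact: cvgV. Qed.

Lemma contX f n : continuous_at x f -> continuous_at x (fun y => f y ^+ n).
Proof.
move=> fc; elim: n => [|n ih]; first exact: cont_cst.
rewrite (_ : (fun y => _) = (fun y => f y * f y ^+ n)); first exact: contM.
by apply/funext => y; rewrite exprS.
Qed.

Lemma cont_max f g : continuous_at x f -> continuous_at x g ->
  continuous_at x (fun y => Num.max (f y) (g y)).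
Proof. by move=> fc gc; apply: (@continuous_max R T f g x). Qed.

Lemma cont_min f g : continuous_at x f -> continuous_at x g ->
  continuous_at x (fun y => Num.min (f y) (g y)).
Proof. by move=> fc gc; apply: (@continuous_min R T f g x). Qed.

Lemma cont_norm f : continuous_at x f -> continuous_at x (fun y => `|f y|).
Proof. exact: cvg_norm. Qed.

Lemma cont_sqrt f : continuous_at x f ->
  continuous_at x (fun y => Num.sqrt (f y)).
Proof. by move=> fc; apply: continuous_comp fc _; exact: sqrt_continuous. Qed.

Lemma cont_sum (I : Type) (s : seq I) (F : I -> T -> R) :
  (forall i, continuous_at x (F i)) ->
  continuous_at x (fun y => \sum_(i <- s) F i y).
Proof.
move=> Fc; elim: s => [|i s ih].
  rewrite (_ : (fun y => _) = fun=> 0); first exact: cont_cst.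
  by apply/funext => y; rewrite big_nil.
rewrite (_ : (fun y => _) = fun y => F i y + \sum_(j <- s) F j y).
  exact: contD.
by apply/funext => y; rewrite big_cons.
Qed.

Lemma cont_bigmax (I : Type) (s : seq I) (F : I -> T -> R) :
  (forall i, continuous_at x (F i)) ->
  continuous_at x (fun y => \big[Num.max/0]_(i <- s) F i y).
Proof.
move=> Fc; elim: s => [|i s ih].
  rewrite (_ : (fun y => _) = fun=> 0); first exact: cont_cst.
  by apply/funext => y; rewrite big_nil.
rewrite (_ : (fun y => _) =
    fun y => Num.max (F i y) (\big[Num.max/0]_(j <- s) F j y)).
  exact: cont_max.
by apply/funext => y; rewrite big_cons.
Qed.

(** Boundedness squeezes the product to 0 where [f] vanishes, so [g] may jump there; the radial
    factor below does. *)
Lemma contM_bounded f g : continuous_at x f -> (forall y, `|g y| <= 1) ->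
  (f x != 0 -> continuous_at x g) -> continuous_at x (fun y => f y * g y).
Proof.
move=> fc g1 gc; have [fx0|fx0] := eqVneq (f x) 0; last first.
  by apply: contM => //; exact: gc.
rewrite /continuous_at fx0 mul0r.
have := cont_norm fc; rewrite /continuous_at fx0 normr0 => nfc.
have nfc' : - `|f y| @[y --> x] --> 0 by rewrite -oppr0; exact: cvgN.
have fg : \forall y \near x, - `|f y| <= f y * g y <= `|f y|.
  by apply: nearW => y; rewrite -ler_norml normrM ler_piMr.
exact: (squeeze_cvgr fg nfc' nfc).
Qed.

End continuity.

Ltac cont := repeat first
  [ exact: cont_cst | assumption | exact: eval_continuous
  | apply: contD | apply: contN | apply: contM | apply: contX | apply: cont_max
  | apply: cont_min | apply: cont_norm | apply: cont_sqrt
  | (apply: cont_sum; move=> ?) | (apply: cont_bigmax; move=> ?) ].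

(** * Infinite cardinals *)

Lemma infinite_inj_nat (T : Type) (A : set T) : infinite_set A ->
  exists2 u : nat -> T, injective u & forall n, A (u n).
Proof.
move=> /infiniteP/card_leP[f].
exists (fun n => val (f (SigSub (in_setT n)))) => [m n /val_inj/inj|n].
  by move=> /(_ (in_setT _) (in_setT _)) [].
exact: set_valP.
Qed.

(* Zorn's lemma on the graphs of injections [A * nat -> A], [A] a set: the
   domain of a maximal one is cofinite. *)
Lemma infinite_prod_nat_inj (K : Type) :
  infinite_set [set: K] -> exists f : K * nat -> K, injective f.
Proof.
move=> infK.
(* The clauses say in turn: functional, injective, domain of the form [A * nat], values in [A]. *)
pose P (G : set ((K * nat) * K)) :=
  [/\ forall a b b', G (a, b) -> G (a, b') -> b = b',
      forall a a' b, G (a, b) -> G (a', b) -> a = a',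
      forall k n b m, G ((k, n), b) -> exists c, G ((k, m), c) &
      forall k n b m, G ((k, n), b) -> exists c, G ((b, m), c)].
have [|G [[Gf Gi Gd Gr] Gmax]] := @Zorn_bigcup _ P.
  move=> F FP Ftot.
  have Fpair p q : (\bigcup_(X in F) X) p -> (\bigcup_(X in F) X) q ->
      exists X, [/\ F X, X p & X q].
    move=> [X FX Xp] [Y FY Yq]; have [XY|YX] := Ftot _ _ FX FY.
    - by exists Y; split => //; exact: XY.
    - by exists X; split => //; exact: YX.
  split.
  - move=> a b b' /Fpair h /h [X [FX Xp Xq]].
    by have [f _ _ _] := FP _ FX; exact: f Xp Xq.
  - move=> a a' b /Fpair h /h [X [FX Xp Xq]].
    by have [_ f _ _] := FP _ FX; exact: f Xp Xq.
  - move=> k n b m [X FX Xk]; have [_ _ f _] := FP _ FX.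
    by have [c Xc] := f _ _ _ m Xk; exists c, X.
  - move=> k n b m [X FX Xk]; have [_ _ _ f] := FP _ FX.
    by have [c Xc] := f _ _ _ m Xk; exists c, X.
pose A := [set k | exists c, G ((k, 0%N), c)].
have AG k n : A k -> exists c, G ((k, n), c).
  by move=> [c kc]; exact: Gd _ _ _ n kc.
have GA k n c : G ((k, n), c) -> A k by move=> /Gd; exact.
have GA' k n c : G ((k, n), c) -> A c by move=> /Gr; exact.
(* Otherwise a sequence [u] outside [A] extends the graph, by sending [(u i, j)] to [u] at the code
   of [(i, j)]. *)
have finC : finite_set (~` A).
  apply: contrapT => /infinite_inj_nat[u ui uA].
  pose H : set ((K * nat) * K) :=
    [set p | exists i j, p = ((u i, j), u (pickle (i, j)))].
  apply: (Gmax (G `|` H)).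
    split=> [p Gp|]; first by left.
    move=> /(_ ((u 0%N, 0%N), u (pickle (0%N, 0%N))))-/(_ _)/GA/uA; apply.
    by right; exists 0%N, 0%N.
  split.
  - move=> a b b' [Gab|[i [j [-> ->]]]] [Gab'|[i' [j' [e e']]]].
    + exact: Gf Gab Gab'.
    + by move: Gab; rewrite e => /GA/uA.
    + by move: Gab' => /GA/uA.
    + by move: e e' => /ui <- <- ->.
  - move=> a a' b [Gab|[i [j [-> ->]]]] [Gab'|[i' [j' [e e']]]].
    + exact: Gi Gab Gab'.
    + by move: Gab; case: a => a n; rewrite e' => /GA'/uA.
    + by move: Gab'; case: a' => a' n /GA'/uA.
    + by move: e' e => /ui/(pcan_inj pickleK)[<- <-] ->.
  - move=> k n b m [Gk|[i [j [-> _ _]]]].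
      by have [c ?] := Gd _ _ _ m Gk; exists c; left.
    by exists (u (pickle (i, m))); right; exists i, m.
  - move=> k n b m [Gk|[i [j [_ _ ->]]]].
      by have [c ?] := Gr _ _ _ m Gk; exists c; left.
    by exists (u (pickle (pickle (i, j), m))); right; exists (pickle (i, j)), m.
have [a0 Aa0] : A !=set0.
  apply/set0P/eqP => A0; apply: infK.
  by move: finC; rewrite A0 setC0.
have /choice[g gP] : forall p : K * nat, exists c, A p.1 -> G (p, c).
  move=> [k n] /=.
  have [/(AG _ n)[c Gc]|nA] := pselect (A k); first by exists c.
  by exists a0.
have /countable_injP[c ci] := finite_set_countable finC.
(* Embeds [K] into [A * nat]: second component 0 on [A], and positive ones over [a0] for the
   finitely many other points. Then [g] brings [K] into [A], and a second use of [g] absorbs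
   [nat]. *)
pose e k := if pselect (A k) then (k, 0%N) else (a0, (c k).+1).
have eA k : A (e k).1 by rewrite /e; case: pselect.
have ei : injective e.
  move=> k l; rewrite /e; case: pselect => Ak; case: pselect => Al //.
  - by case.
  - by move=> [ckl]; apply: ci => //; rewrite inE.
have gi p q : A p.1 -> A q.1 -> g p = g q -> p = q.
  by move=> /gP Gp /gP Gq gpq; apply: Gi Gp _; rewrite gpq.
have gA p : A p.1 -> A (g p) by case: p => k n /gP /GA'.
exists (fun p => g (g (e p.1), p.2)) => -[k n] [l m] /=.
move=> /(gi (_, _) (_, _) (gA _ (eA k)) (gA _ (eA l)))[+ ->].
by move=> /(gi _ _ (eA k) (eA l))/ei ->.
Qed.

(** Cantor-Bernstein, after absorbing [nat] into [K]. The index sets below are built from [K] and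
    countable types, so [i] and [j] are easy to give. *)
Lemma infinite_bij (K J : Type) (i : J -> K * nat) (j : K -> J) :
  infinite_set [set: K] -> injective i -> injective j ->
  exists f : K -> J, bijective f.
Proof.
move=> /infinite_prod_nat_inj[h hi] ii ji.
have JK : ([set: J] #<= [set: K])%card.
  suff /injfunPex[f] : exists2 f, set_fun [set: J] [set: K] f &
      set_inj setT f by exact: inj_card_le f.
  by exists (h \o i) => // x y _ _ /hi/ii.
have KJ : ([set: K] #<= [set: J])%card.
  suff /injfunPex[f] : exists2 f, set_fun [set: K] [set: J] f &
      set_inj setT f by exact: inj_card_le f.
  by exists j => // x y _ _ /ji.
have /card_bijP[f [g fg gf]] := Cantor_Bernstein KJ JK.
exists (fun k => val (f (SigSub (in_setT k)))).
exists (fun x => val (g (SigSub (in_setT x)))) => x.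
- rewrite (_ : SigSub _ = f (SigSub (in_setT x))) ?fg //; exact/val_inj.
- rewrite (_ : SigSub _ = g (SigSub (in_setT x))) ?gf //; exact/val_inj.
Qed.

(** * Mass-preserving maps and blocks *)

Section weighted_boxes.
Context (R : realType).
Implicit Types (phi : R -> R) (J : choiceType).

(* The mass: [phi] is the absolute value, or the square after the change of
   coordinates [r |-> r * `|r|]. *)
Definition tot phi J (x : J -> R) : \bar R :=
  (\esum_(j in [set: J]) (phi (x j))%:E)%E.

Definition Box phi J (lo hi : J -> R) : set {ptws J -> R} :=
  [set x | (tot phi x <= 1%:E)%E /\ forall j, lo j <= x j <= hi j].

(** The mass is kept exactly, not just its bound by 1: all blocks of a ball share one bound, so they
    can be replaced independently only at equal mass. *)
Definition tot_iso phi J1 J2 (lo1 hi1 : J1 -> R) (lo2 hi2 : J2 -> R)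
    (h : {ptws J1 -> R} -> {ptws J2 -> R}) : Prop :=
  [/\ continuous h, set_bij (Box phi lo1 hi1) (Box phi lo2 hi2) h &
      forall x, Box phi lo1 hi1 x -> tot phi (h x) = tot phi x].

Lemma esum_leP J (a : J -> \bar R) (c : \bar R) :
  (\esum_(j in [set: J]) a j <= c)%E <->
  forall X, finite_set X -> (\sum_(j \in X) a j <= c)%E.
Proof.
split=> [ac X fX|h].
  by apply: le_trans ac; apply: ereal_sup_ubound; exists X.
by apply: ge_ereal_sup => _ [X [fX _] <-]; exact: h.
Qed.

(** The mass need not be pointwise continuous, but bounding it is an intersection of closed
    conditions, one for each finite set of coordinates. *)
Lemma closed_tot_le phi J (c : R) : continuous phi ->
  closed [set x : {ptws J -> R} | (tot phi x <= c%:E)%E].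
Proof.
move=> phic.
have -> : [set x : {ptws J -> R} | (tot phi x <= c%:E)%E] =
    \bigcap_(X in [set X : set J | finite_set X])
      [set x : {ptws J -> R} | \sum_(j <- finmap.enum_fset (fset_set X)) phi (x j) <= c].
  apply/seteqP; split=> x /=.
    move=> /esum_leP h X fX /=; have := h X fX.
    by rewrite fsbig_finite//= sumEFin lee_fin.
  move=> h; apply/esum_leP => X fX; have := h X fX => /=.
  by rewrite fsbig_finite//= sumEFin lee_fin.
apply: closed_bigI => X _.
have /continuous_closedP/(_ [set r | r <= c]) h : continuous
    (fun x : {ptws J -> R} => \sum_(j <- finmap.enum_fset (fset_set X)) phi (x j)).
  move=> x; apply: cont_sum => j.
  apply: (@continuous_comp _ _ _ (fun x : {ptws J -> R} => x j) phi).
    exact: eval_continuous.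
  exact: phic.
exact/h/closed_le.
Qed.

Lemma compact_Box phi J (lo hi : J -> R) : continuous phi ->
  compact (Box phi lo hi).
Proof.
move=> phic.
have -> : Box phi lo hi = [set x : {ptws J -> R} | forall j, [set` `[lo j, hi j]] (x j)] `&`
    [set x : {ptws J -> R} | (tot phi x <= 1%:E)%E].
  apply/seteqP; split=> x /=.
    by move=> [? h]; split=> // j; have := h j; rewrite in_itv.
  by move=> [h ?]; split=> // j; have := h j; rewrite in_itv.
apply: compact_closedI; last exact: closed_tot_le.
by apply: (@tychonoff J (fun=> R) (fun j => [set` `[lo j, hi j]])) => j;
  exact: segment_compact.
Qed.

Lemma tot_iso_homeomorphic phi J1 J2 (lo1 hi1 : J1 -> R) (lo2 hi2 : J2 -> R) h :
  continuous phi -> tot_iso phi lo1 hi1 lo2 hi2 h ->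
  homeomorphic (set_type (Box phi lo1 hi1)) (set_type (Box phi lo2 hi2)).
Proof.
move=> phic [hc hb _]; apply: (homeomorphic_set_bij _ _ hc hb).
- exact: hausdorff_ptws.
- exact: compact_Box.
Qed.

Lemma reindex_tot_iso phi J1 J2 (e : J1 -> J2) (lo hi : J2 -> R) :
  bijective e ->
  tot_iso phi lo hi (lo \o e) (hi \o e) (fun x : {ptws J2 -> R} => x \o e).
Proof.
move=> [e' ee' e'e].
have toteE (x : J2 -> R) : tot phi (x \o e) = tot phi x.
  rewrite /tot [RHS](@reindex_esum _ _ _ setT setT e)// setTT_bijective.
  by exists e'.
split.
- by apply: ptws_continuous => j; exact: eval_continuous.
- split.
  + by move=> x [tx bx]; split=> [|j]; [rewrite toteE|exact: bx].
  + by move=> x y _ _ /funeqP xy; apply/funext => j; rewrite -(e'e j); exact: xy.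
  + move=> y [ty by_]; exists (y \o e'); last first.
      by apply/funext => j /=; rewrite ee'.
    split; last by move=> j /=; have := by_ (e' j); rewrite /= e'e.
    by rewrite -toteE (_ : _ \o e = y)//; apply/funext => j /=; rewrite ee'.
- by move=> x _; exact: toteE.
Qed.

Lemma esum_sumtype (A B : choiceType) (a : A + B -> \bar R) :
  (forall j, 0 <= a j)%E ->
  (\esum_(j in [set: A + B]) a j =
   \esum_(j in [set: A]) a (inl j) + \esum_(j in [set: B]) a (inr j))%E.
Proof.
move=> a0; rewrite (esumID (range inl)) //; congr (_ + _)%E.
- apply: reindex_esum; split.
  + by move=> x _; split=> //; exists x.
  + by move=> x y _ _ [].
  + by move=> _ [_ [x _ <-]]; exists x.
- apply: reindex_esum; split.
  + by move=> x _; split=> // -[].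
  + by move=> x y _ _ [].
  + by move=> [x|x] [_ h]; [case: h; exists x|exists x].
Qed.

Section blocks.
Context (D I : choiceType) (phi : R -> R) (phi0 : forall r, 0 <= phi r).

(** [D] indexes the coordinates left alone and [I] the blocks, all of the same shape [T]. *)
Definition glue (T : Type) (d : D -> R) (b : I -> T -> R) (j : D + I * T) : R :=
  match j with inl i => d i | inr (i, t) => b i t end.

Definition block (T : Type) (x : D + I * T -> R) (i : I) (t : T) : R :=
  x (inr (i, t)).

Lemma tot_glue (T : choiceType) (x : D + I * T -> R) :
  (tot phi x = tot phi (x \o inl) +
    \esum_(i in [set: I]) tot phi (block x i))%E.
Proof.
have p0 (j : D + I * T) : (0 <= (phi (x j))%:E)%E by rewrite lee_fin.
rewrite /tot esum_sumtype//; congr (_ + _)%E.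
rewrite esum_esum//; last by move=> i j _ _; rewrite lee_fin.
rewrite (_ : _ `*`` _ = setT); last by apply/seteqP; split.
by apply: eq_esum => -[].
Qed.

Lemma tot_ge0 (T : choiceType) (x : T -> R) : (0 <= tot phi x)%E.
Proof. by apply: esum_ge0 => i _; rewrite lee_fin. Qed.

Lemma tot_block_le (T : choiceType) (x : D + I * T -> R) i :
  (tot phi (block x i) <= tot phi x)%E.
Proof.
rewrite [leRHS]tot_glue; apply: (@le_trans _ _ (\esum_(i in [set: I]) tot phi (block x i))%E).
  apply: esum_ge; exists [set i]; first by split.
  by rewrite fsbig_set1.
by rewrite leeDr// tot_ge0.
Qed.

(** A block weighs no more than the whole point, so [h] applies to it and keeps its mass. Each
    output coordinate depends on a single block or a single ordinary coordinate, whence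
    continuity. *)
Lemma block_tot_iso (T1 T2 : choiceType) (loD hiD : D -> R)
    (lo1 hi1 : T1 -> R) (lo2 hi2 : T2 -> R) h :
  tot_iso phi lo1 hi1 lo2 hi2 h ->
  tot_iso phi (glue loD (fun=> lo1)) (glue hiD (fun=> hi1))
    (glue loD (fun=> lo2)) (glue hiD (fun=> hi2))
    (fun x : {ptws D + I * T1 -> R} => glue (x \o inl) (fun i => h (block x i))).
Proof.
move=> [hc [hB hinj hsurj] htot].
have blk (T : choiceType) (lo hi : T -> R) (x : D + I * T -> R) :
    Box phi (glue loD (fun=> lo)) (glue hiD (fun=> hi)) x ->
    forall i, Box phi lo hi (block x i).
  move=> [tx bx] i; split; first exact: le_trans (tot_block_le x i) tx.
  by move=> t; exact: bx (inr (i, t)).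
have totE (x : D + I * T1 -> R) : (forall i, Box phi lo1 hi1 (block x i)) ->
    tot phi (glue (x \o inl) (fun i => h (block x i))) = tot phi x.
  move=> bx; rewrite [LHS]tot_glue [RHS]tot_glue; congr (_ + _)%E.
  by apply: eq_esum => i _; rewrite -[RHS]htot.
split.
- apply: ptws_continuous => -[d|[i t]] /=; first exact: eval_continuous.
  move=> x.
  apply: (@continuous_comp {ptws D + I * T1 -> R} {ptws T2 -> R} R
    (fun x => h (block x i)) (fun y => y t)); last exact: eval_continuous.
  apply: (@continuous_comp {ptws D + I * T1 -> R} {ptws T1 -> R} {ptws T2 -> R}
    (fun x => block x i) h); last exact: hc.
  by apply: ptws_continuous => s; exact: eval_continuous.
- split.
  + move=> x xB; have bx := blk _ _ _ _ xB; split.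
      by rewrite totE//; case: xB.
    move=> [d|[i t]] /=; first by case: xB => _ /(_ (inl d)).
    by have [_] := hB _ (bx i); exact.
  + move=> x y /set_mem/blk xB /set_mem/blk yB xy; apply/funext => -[d|[i t]].
      by have /funeqP/(_ (inl d)) := xy.
    have : block x i = block y i.
      apply: hinj; [exact: mem_set|exact: mem_set|apply/funext=> s].
      by have /funeqP/(_ (inr (i, s))) := xy.
    by move=> /funeqP/(_ t).
  + move=> y yB; have by_ := blk _ _ _ _ yB.
    have /choice[x xP] : forall i, exists x, Box phi lo1 hi1 x /\ h x = block y i.
      by move=> i; have [x ? ?] := hsurj _ (by_ i); exists x.
    have gE : glue (glue (y \o inl) x \o inl) (fun i => h (block (glue (y \o inl) x) i)) = y.
      by apply/funext => -[d|[i t]] //=; rewrite (xP i).2.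
    exists (glue (y \o inl) x) => //; split.
      by rewrite -totE ?gE; [case: yB|move=> i; case: (xP i)].
    move=> [d|[i t]] /=; first by case: yB => _ /(_ (inl d)).
    by have [[_]] := xP i; exact.
- by move=> x /blk xB; exact: totE.
Qed.

End blocks.
End weighted_boxes.

(** * Finite blocks *)

Section finite_blocks.
Context (R : realType).

Lemma tot_fin (phi : R -> R) (T : finType) (x : T -> R) :
  (forall r, 0 <= phi r) -> tot phi x = (\sum_t phi (x t))%:E.
Proof.
move=> phi0; rewrite /tot esum_fset; [|exact: finite_finset|].
  rewrite -sumEFin [RHS]fsbig_seq ?index_enum_uniq//; apply: eq_fsbigl.
  by apply/seteqP; split=> t //= _; exact: mem_index_enum.
by move=> i _; rewrite lee_fin.
Qed.

(** At mass [r] the signed coordinate fills the segment of radius [min r t]. The factor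
    [max 1 (r / t)] enlarges the radius to [r], which gives the range of the difference of two
    nonnegative numbers with sum [r]. *)
Definition pair_map (t : R) (x : {ptws bool -> R}) : {ptws bool -> R} :=
  fun b => let r := `|x false| + `|x true| in
    let u := x true * Num.max 1 (r / t) in
    if b then (r - u) / 2 else (r + u) / 2.

Lemma pair_tot_iso (t : R) : 0 < t -> t <= 1 ->
  tot_iso Num.norm (fun b : bool => if b then - t else 0)
    (fun b : bool => if b then t else 1) (fun=> 0) (fun=> 1) (pair_map t).
Proof.
move=> t0 t1.
have totb (x : bool -> R) : tot Num.norm x = (`|x false| + `|x true|)%:E.
  by rewrite tot_fin// big_bool addrC.
pose mu (r : R) := Num.max 1 (r / t).
have mu1 r : 1 <= mu r by rewrite le_max lexx.
have mu0 r : 0 < mu r by exact: lt_le_trans (mu1 r).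
have rmu r : r <= t * mu r.
  by rewrite mulrC -ler_pdivrMr// le_max lexx orbT.
have muE r : mu r = 1 \/ t * mu r = r.
  rewrite /mu; have [h|h] := leP 1 (r / t); last by left.
  by right; rewrite mulrCA divff ?mulr1 ?gt_eqF.
have ule (z u : R) : 0 <= z -> `|u| <= t -> `|u| * mu (z + `|u|) <= z + `|u|.
  move=> z0 ut; have [->|h] := muE (z + `|u|); first by rewrite mulr1 lerDr.
  by rewrite -[leRHS]h ler_wpM2r// ltW.
have lo1 x : Box Num.norm (fun b : bool => if b then - t else 0)
    (fun b : bool => if b then t else 1) x ->
    [/\ `|x true| <= t, 0 <= x false & x false + `|x true| <= 1].
  rewrite /Box /= totb lee_fin => -[s b].
  have /= bt := b true; have /= /andP[bf _] := b false.
  by split => //; [rewrite ler_norml|move: s; rewrite (ger0_norm bf)].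
have pE x : 0 <= x false -> pair_map t x =
    fun b => let r := x false + `|x true| in
      if b then (r - x true * mu r) / 2 else (r + x true * mu r) / 2.
  by move=> x0; rewrite /pair_map (ger0_norm x0).
have pge0 x : 0 <= x false -> `|x true| <= t ->
    [/\ 0 <= pair_map t x true, 0 <= pair_map t x false &
    pair_map t x false + pair_map t x true = x false + `|x true|].
  move=> x0 xt; have := ule _ _ x0 xt; rewrite pE //=.
  set r := _ + _; rewrite -[X in _ * X](gtr0_norm (mu0 r)) -normrM ler_norml.
  by move=> /andP[]; split; lra.
split.
- by apply: ptws_continuous => -[] x; rewrite /pair_map; cont.
- split.
  + move=> x /lo1[xt x0 x1]; have [p1 p2 p3] := pge0 _ x0 xt.
    rewrite /Box /= totb lee_fin (ger0_norm p1) (ger0_norm p2) p3; split => //.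
    by case; lra.
  + move=> x y /set_mem/lo1[xt x0 _] /set_mem/lo1[yt y0 _] exy.
    have [_ _] := pge0 _ x0 xt; have [_ _] := pge0 _ y0 yt.
    rewrite exy => -> rE.
    have := exy; rewrite (pE _ x0) (pE _ y0) => /funeqP/(_ true) /=.
    rewrite rE => uE.
    have ut : x true = y true.
      apply: (mulIf (lt0r_neq0 (mu0 (x false + `|x true|)))); lra.
    by apply/funext => -[//|]; move: rE; rewrite ut => /addIr ->.
  + move=> y; rewrite {1}/Box /= totb lee_fin => -[s b].
    have /= /andP[y1 _] := b true; have /= /andP[y0 _] := b false.
    move: s; rewrite (ger0_norm y0) (ger0_norm y1) => s.
    pose r := y false + y true; pose u := (y false - y true) / mu r.
    have ur : `|u| * mu r <= r.
      rewrite -[X in _ * X](gtr0_norm (mu0 r)) -normrM divfK ?gt_eqF//.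
      by rewrite ler_norml /r; lra.
    have ur' : `|u| <= r.
      by apply: le_trans ur; rewrite ler_peMr.
    have ut : `|u| <= t.
      by rewrite -(ler_pM2r (mu0 r)); exact: le_trans (rmu r).
    exists (fun b => if b then u else r - `|u|).
      rewrite /Box /= totb /= lee_fin; split.
        by rewrite ger0_norm ?subr_ge0// subrK.
      case; rewrite -?ler_norml// subr_ge0 ur' /=.
      by apply: le_trans s; rewrite gerBl.
    have -> : y = fun b => if b then y true else y false by apply/funext; case.
    rewrite pE /= ?subr_ge0// subrK /u; apply/funext => -[] /=; 
      rewrite divfK ?gt_eqF// /r; lra.
- move=> x /lo1[xt x0 x1]; have [p1 p2 p3] := pge0 _ x0 xt.
  by rewrite !totb (ger0_norm p1) (ger0_norm p2) p3 (ger0_norm x0).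
Qed.

End finite_blocks.

(** * Radial rescaling of a simplex *)

Section radial.
Context (R : realType) (m : nat).

Definition maxp (d : 'I_m -> R) : R := \big[Num.max/0]_i d i.

Lemma maxp_ge0 d : 0 <= maxp d.
Proof. exact: bigmax_ge_id. Qed.

Lemma maxp_ge d i : d i <= maxp d.
Proof. exact: (le_bigmax_cond _ d). Qed.

Lemma maxp_le d B : 0 <= B -> (forall i, d i <= B) -> maxp d <= B.
Proof. by move=> B0 dB; apply/bigmax_leP; split. Qed.

Lemma maxp_scale k d : 0 < k -> maxp (fun i => k * d i) = k * maxp d.
Proof.
move=> k0; apply/le_anti/andP; split.
  apply: maxp_le => [|i]; first by rewrite mulr_ge0 ?maxp_ge0// ltW.
  by rewrite ler_pM2l// maxp_ge.
rewrite -ler_pdivlMl//; apply: maxp_le => [|i].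
  by rewrite mulr_ge0 ?maxp_ge0// invr_ge0 ltW.
by rewrite ler_pdivlMl// (maxp_ge (fun i => k * d i)).
Qed.

Lemma maxp_gt0 d i : \sum_j d j = 0 -> d i != 0 -> 0 < maxp d.
Proof.
move=> ds di; rewrite lt_neqAle maxp_ge0 andbT eq_sym.
apply: contraNneq di => md.
have d0 j : 0 <= - d j by rewrite oppr_ge0 -md maxp_ge.
have : \sum_j - d j = 0 by rewrite sumrN ds oppr0.
by move/psumr_eq0P => /(_ (fun j _ => d0 j) i isT)/eqP; rewrite oppr_eq0.
Qed.

Lemma maxpN_gt0 d i : \sum_j d j = 0 -> d i != 0 -> 0 < maxp (fun j => - d j).
Proof.
by move=> ds di; apply: (@maxp_gt0 _ i); rewrite ?sumrN ?ds ?oppr0 ?oppr_eq0.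
Qed.

(* On the level [{sum = m c}], the simplex and its part below [t] are star-shaped
   around the constant vector [c]; [d] is the vector from that center. *)
Definition rfactor (t c : R) (d : 'I_m -> R) : R :=
  Num.min 1 (Num.max 0 (((t - c) * maxp (fun i => - d i)) / (c * maxp d))).

Lemma rfactor_ge0 t c d : 0 <= rfactor t c d.
Proof. by rewrite le_min ler01 le_max lexx. Qed.

Lemma rfactor_le1 t c d : rfactor t c d <= 1.
Proof. by rewrite ge_min lexx. Qed.

(** The factor depends only on the ray of [d]. Where it is positive it can thus be computed from the
    image point too, which inverts the map. *)
Lemma rfactor_scale t c d k : 0 < k -> 
  rfactor t c (fun i => k * d i) = rfactor t c d.
Proof.
move=> k0; rewrite /rfactor maxp_scale//.
rewrite (_ : (fun i => - (k * d i)) = (fun i => k * - d i)); last first.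
  by apply/funext => i; rewrite mulrN.
by rewrite maxp_scale// ![_ * (k * _)]mulrCA -mulf_div divff ?mul1r ?gt_eqF.
Qed.

Definition center (x : 'I_m -> R) : R := (\sum_i `|x i|) / m%:R.

Definition radial_map t (x : {ptws 'I_m -> R}) : {ptws 'I_m -> R} :=
  fun i => center x + (`|x i| - center x) *
    rfactor t (center x) (fun j => `|x j| - center x).

Context (m0 : (0 < m)%N).
Let m0' : 0 < m%:R :> R. Proof. by rewrite ltr0n. Qed.

Lemma sum_center x : \sum_i (`|x i| - center x) = 0.
Proof.
rewrite sumrB sumr_const card_ord -mulr_natr divfK ?subrr//.
exact: lt0r_neq0.
Qed.

Lemma center_ge0 x : 0 <= center x.
Proof. by rewrite divr_ge0 ?sumr_ge0. Qed.

(** A nonzero deviation from the center forces both the center and [maxp d] to be positive, so the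
    quotient in the factor is continuous; [contM_bounded] covers zero deviations. *)
Lemma radial_continuous t : continuous (radial_map t).
Proof.
apply: ptws_continuous => i x; rewrite /radial_map.
have cc : continuous_at x (fun x : {ptws 'I_m -> R} => center x).
  by rewrite /center; cont.
apply: contD => //; apply: contM_bounded; first by cont.
  by move=> y; rewrite ger0_norm ?rfactor_ge0 ?rfactor_le1.
move=> dx; rewrite /rfactor; apply: cont_min; first exact: cont_cst.
apply: cont_max; first exact: cont_cst.
apply: contM; first by rewrite /maxp; cont.
apply: contV; last by rewrite /maxp; cont.
rewrite mulf_neq0//; last by apply/lt0r_neq0/(maxp_gt0 (sum_center _) dx).
apply: contraNneq dx => c0; rewrite c0 subr0.
move: c0 => /eqP; rewrite mulf_eq0 invr_eq0 (gt_eqF m0') orbF.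
by move=> /eqP/psumr_eq0P => /(_ (fun j _ => normr_ge0 (x j)) i isT) ->.
Qed.

(** In direction [d] from the center [c], the simplex ends at the multiple [c / maxp (- d)], and its
    part below [t] at the minimum of this and [(t - c) / maxp d]. The second divided by the first is
    [rfactor]. *)
Lemma radial_tot_iso t : 0 < t -> 1 < m%:R * t ->
  tot_iso Num.norm (fun=> 0) (fun=> 1) (fun=> 0) (fun=> t) (radial_map t).
Proof.
move=> t0 mt.
have totE (x : 'I_m -> R) : tot Num.norm x = (m%:R * center x)%:E.
  by rewrite tot_fin// mulrC divfK// gt_eqF.
have totc (x : 'I_m -> R) : (tot Num.norm x <= 1%:E)%E -> center x < t.
  by rewrite totE lee_fin => h; rewrite -(ltr_pM2l m0'); exact: le_lt_trans mt.
have rpos c (d : 'I_m -> R) i : c < t -> 0 < c -> \sum_j d j = 0 -> d i != 0 ->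
    0 < rfactor t c d.
  move=> ct c0 ds di; rewrite lt_min ltr01 lt_max; apply/orP; right.
  by rewrite divr_gt0 ?mulr_gt0 ?subr_gt0 ?(maxp_gt0 ds di)// (maxpN_gt0 ds di).
have cpos (x : 'I_m -> R) i : `|x i| - center x != 0 -> 0 < center x.
  move=> di; rewrite lt_neqAle center_ge0 andbT eq_sym; apply: contraNneq di => c0.
  rewrite c0 subr0; move: c0 => /eqP; rewrite mulf_eq0 invr_eq0 (gt_eqF m0') orbF.
  by move=> /eqP/psumr_eq0P => /(_ (fun j _ => normr_ge0 (x j)) i isT) ->.
have rge (x : 'I_m -> R) i : 0 <= radial_map t x i.
  rewrite /radial_map; set c := center x; set d := fun j => _.
  have r0 := rfactor_ge0 t c d; have r1 := rfactor_le1 t c d.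
  have := center_ge0 x; have := normr_ge0 (x i); rewrite -/c => x0 c0.
  by set r := rfactor _ _ _ in r0 r1 *; nra.
have sumE (x : 'I_m -> R) k :
    \sum_i (center x + (`|x i| - center x) * k) = \sum_i `|x i|.
  rewrite big_split/= -[X in _ + X]mulr_suml sum_center mul0r addr0 sumr_const card_ord.
  by rewrite -mulr_natr divfK// gt_eqF.
have cE (x : 'I_m -> R) : center (radial_map t x) = center x.
  rewrite {1}/center (eq_bigr (fun i => radial_map t x i)); last first.
    by move=> i _; rewrite ger0_norm.
  by rewrite /radial_map sumE.
have le1 (x : 'I_m -> R) i : (tot Num.norm x <= 1%:E)%E -> `|x i| <= 1.
  rewrite tot_fin// lee_fin; apply: le_trans.
  by rewrite (bigD1 i)//= lerDl sumr_ge0.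
split.
- exact: radial_continuous.
- split.
  + move=> x [tx bx]; split; first by rewrite totE cE -totE.
    move=> i; rewrite rge/= /radial_map; set c := center x.
    set d := fun j => `|x j| - c; rewrite -/(d i).
    have ct : c < t by exact: totc.
    have r0 := rfactor_ge0 t c d; have r1 := rfactor_le1 t c d.
    have [di|di] := leP (d i) 0.
      by apply: le_trans (ltW ct); rewrite gerDl mulr_le0_ge0.
    have c0 : 0 < c by apply: (cpos x i); rewrite gt_eqF.
    have a0 : 0 < maxp d by exact: lt_le_trans (maxp_ge d i).
    have bc : maxp (fun j => - d j) <= c.
      by apply: maxp_le => [|j]; [exact: ltW|rewrite opprB gerBl].
    rewrite -lerBrDl; apply: (@le_trans _ _ (maxp d * rfactor t c d)).
      by rewrite ler_wpM2r// maxp_ge.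
    apply: (@le_trans _ _ (maxp d * ((t - c) * maxp (fun j => - d j) / (c * maxp d)))).
      rewrite ler_wpM2l ?(ltW a0)// ge_min; apply/orP; right.
      rewrite max_r// divr_ge0// mulr_ge0 ?maxp_ge0 ?(ltW c0) ?(ltW a0)//.
      by rewrite subr_ge0 ltW.
    rewrite (_ : _ * (_ / _) = (t - c) * maxp (fun j => - d j) / c); last first.
      by field; rewrite !gt_eqF.
    rewrite ler_pdivrMr//; by rewrite ler_wpM2l// subr_ge0 ltW.
  + move=> x y /set_mem[tx bx] /set_mem[ty by_] exy.
    have cxy : center x = center y by rewrite -cE exy cE.
    have cx : center x < t by exact: totc.
    pose d x i := `|x i| - center x : R.
    have dE i : d x i * rfactor t (center x) (d x) =
        d y i * rfactor t (center x) (d y).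
      have /funeqP/(_ i) := exy; rewrite /radial_map cxy => /addrI.
      by rewrite /d cxy.
    have rposx i : d x i != 0 -> 0 < rfactor t (center x) (d x).
      by move=> dx; apply: rpos cx (cpos _ _ dx) (sum_center x) dx.
    have rposy i : d y i != 0 -> 0 < rfactor t (center x) (d y).
      move=> dy; rewrite cxy; apply: rpos (cpos _ _ dy) (sum_center y) dy.
      by rewrite -cxy.
    have {}dE i : d x i = d y i.
      have [dx|dx] := eqVneq (d x i) 0.
        have [->//|dy] := eqVneq (d y i) 0.
        have := dE i; rewrite dx mul0r => /esym/eqP.
        by rewrite mulf_eq0 (negbTE dy) gt_eqF// (rposy i).
      have [dy|dy] := eqVneq (d y i) 0.
        have := dE i; rewrite dy mul0r => /eqP.
        by rewrite mulf_eq0 (negbTE dx) gt_eqF// (rposx i).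
      have rx := rposx _ dx; have ry := rposy _ dy.
      have rE : rfactor t (center x) (d x) = rfactor t (center x) (d y).
        rewrite -(@rfactor_scale t _ (d x) _ (divr_gt0 rx ry)); congr rfactor.
        by apply/funext => j; rewrite mulrAC [X in X / _]mulrC dE mulfK ?gt_eqF.
      by have := dE i; rewrite rE => /mulIf; apply; rewrite gt_eqF.
    apply/funext => i; have /= := dE i; rewrite /d cxy => /addIr.
    by rewrite !ger0_norm//; [case/andP: (by_ i)|case/andP: (bx i)].
  + move=> y [ty by_]; set c := center y; pose d i := y i - c.
    have y0 i : 0 <= y i by case/andP: (by_ i).
    have dE : d = fun i => `|y i| - c by apply/funext => i; rewrite ger0_norm.
    have ds : \sum_i d i = 0 by rewrite dE sum_center.
    have ct : c < t by exact: totc.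
    have c0 := center_ge0 y; rewrite -/c in c0.
    have [[i di]|/forallNP nd] := pselect (exists i, d i != 0); last first.
      exists y; first by split=> // i; rewrite y0/=; have := le1 _ i ty;
        rewrite ger0_norm.
      apply/funext => i; rewrite /radial_map (_ : _ - _ = 0); last first.
        by have /negP := nd i; rewrite negbK dE => /eqP.
      by rewrite mul0r addr0; apply/eqP; rewrite -subr_eq0 -opprB oppr_eq0;
        have /negP := nd i; rewrite negbK.
    have cgt0 : 0 < c by apply: (cpos y i); move: di; rewrite dE.
    pose r := rfactor t c d; have r0 : 0 < r by exact: rpos di.
    have a0 := maxp_gt0 ds di; have b0 := maxpN_gt0 ds di.
    (* This keeps the coordinates nonnegative when the factor is undone. For factor 1 it is
       [0 <= y]; otherwise it comes from [y <= t]. *)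
    have br : maxp (fun j => - d j) <= c * r.
      rewrite /r /rfactor; case: (leP 1 (Num.max 0 _)) => _.
        by rewrite mulr1; apply: maxp_le => // j; rewrite opprB gerBl.
      rewrite max_r; last by apply: divr_ge0; apply: mulr_ge0; rewrite ?subr_ge0 ?maxp_ge0 ?(ltW ct).
      rewrite (_ : c * (_ / _) = (t - c) * maxp (fun j => - d j) / maxp d); last first.
        by field; rewrite !gt_eqF.
      rewrite ler_pdivlMr//.
      rewrite mulrC ler_wpM2r ?(ltW b0)//; apply: maxp_le => [|j].
        by rewrite subr_ge0 ltW.
      by rewrite lerB//; case/andP: (by_ j).
    pose x i := c + r^-1 * d i.
    have x0 j : 0 <= x j.
      rewrite -(pmulr_rge0 _ r0) mulrDr mulVKf ?gt_eqF//.
      rewrite -lerBlDr sub0r mulrC; apply: le_trans br.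
      exact: (maxp_ge (fun j => - d j)).
    have cx : center x = c.
      rewrite /center (eq_bigr x); last by move=> j _; rewrite ger0_norm.
      rewrite big_split/= -[X in _ + X]mulr_sumr ds mulr0 addr0 sumr_const card_ord.
      by rewrite -(mulr_natr c) mulfK// gt_eqF.
    have tx : (tot Num.norm x <= 1%:E)%E by rewrite totE cx -totE.
    exists x.
      by split=> // j; rewrite x0 /=; have := le1 _ j tx; rewrite ger0_norm.
    apply/funext => j; rewrite /radial_map cx.
    have -> : (fun j => `|x j| - c) = (fun j => r^-1 * d j).
      by apply/funext => k; rewrite ger0_norm// addrAC subrr add0r.
    rewrite rfactor_scale ?invr_gt0// ger0_norm// addrAC subrr add0r -/r.
    by rewrite mulrAC mulVf ?gt_eqF// mul1r addrC subrK.
- by move=> x _; rewrite !totE cE.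
Qed.

End radial.

(** * One step of the carry *)

Section stretch.
Context (R : rcfType).
Implicit Types (D S k u e z x : R).

(* On each circle, the arc of the half-plane [u <= - k] where [S e - D u >= - k] is
   stretched over the whole arc [u <= - k], piecewise linearly in [e]; points with
   [S e - D u >= - k] and [u >= - k] are fixed. Clamping [u] at [- k] makes the
   formula continuous everywhere: on the fixed part the correction vanishes. *)
Definition stretch D S k u e : R * R :=
  let u1 := Num.min u (- k) in
  let b := Num.sqrt (u1 ^+ 2 + e ^+ 2 - k ^+ 2) in
  let e' := e - Num.max 0 (b - e - 2 * (S * k + D * b)) in
  (Num.max u (- k) + k - Num.sqrt (u1 ^+ 2 + e ^+ 2 - e' ^+ 2), e').

Lemma stretch_right D S k u e : 0 <= D -> 0 <= S -> D ^+ 2 + S ^+ 2 = 1 -> 0 <= k ->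
  - k <= u -> - k <= S * e - D * u ->
  stretch D S k u e = (u, e).
Proof.
move=> D0 S0 DS k0 ku h; rewrite /stretch min_r// max_l//.
have -> : (- k) ^+ 2 + e ^+ 2 - k ^+ 2 = e ^+ 2 by ring.
rewrite sqrtr_sqr max_l; last first.
  have [e0|e0] := leP 0 e; rewrite ?(ger0_norm e0) ?(ltr0_norm e0).
    by have := mulr_ge0 S0 k0; have := mulr_ge0 D0 e0; lra.
  suff : (1 + D) * (- e * (1 - D)) <= (1 + D) * (S * k).
    by rewrite ler_pM2l ?ltr_pwDl// => h'; lra.
  have De : D * - k <= D * u by exact: ler_wpM2l.
  have : S * (- e * S) <= S * ((1 + D) * k) by apply: ler_wpM2l => //; lra.
  rewrite (_ : S * (- e * S) = - e * S ^+ 2); last by ring.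
  rewrite (_ : S ^+ 2 = 1 - D ^+ 2); first by lra.
  by rewrite -DS addrAC subrr add0r.
by rewrite subr0 addrK sqrtr_sqr normrN ger0_norm// addrK.
Qed.

Lemma stretch_left D S k u e : u <= - k ->
  let b := Num.sqrt (u ^+ 2 + e ^+ 2 - k ^+ 2) in
  let e' := e - Num.max 0 (b - e - 2 * (S * k + D * b)) in
  stretch D S k u e = (- Num.sqrt (u ^+ 2 + e ^+ 2 - e' ^+ 2), e').
Proof.
by move=> uk b e'; rewrite /stretch min_l// max_r// addNr sub0r.
Qed.

(** [b] is half the chord cut by the line [u = - k] from the circle through [(u, e)]. *)
Lemma left_radius k u e : 0 <= k -> u <= - k ->
  let b := Num.sqrt (u ^+ 2 + e ^+ 2 - k ^+ 2) in
  [/\ 0 <= b, b ^+ 2 = u ^+ 2 + e ^+ 2 - k ^+ 2, - b <= e & e <= b].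
Proof.
move=> k0 uk b; have ku : k ^+ 2 <= u ^+ 2.
  have : 0 <= (- k - u) * (k - u) by apply: mulr_ge0; lra.
  by lra.
have b2 : b ^+ 2 = u ^+ 2 + e ^+ 2 - k ^+ 2.
  by rewrite sqr_sqrtr//; have := sqr_ge0 e; lra.
have : `|e| <= b by rewrite -sqrtr_sqr ler_wsqrtr//; lra.
by rewrite ler_norml => /andP[]; split=> //; exact: sqrtr_ge0.
Qed.

(* The half-plane [S e - D u >= - k] cuts the circle of radius
   [sqrt (b ^+ 2 + k ^+ 2)] at the point with [e = - (S k + D b)]. *)
Lemma left_region D S k u e b : 0 <= D -> 0 <= S -> D ^+ 2 + S ^+ 2 = 1 ->
  0 <= k -> u <= - k -> 0 <= b ->
  b ^+ 2 = u ^+ 2 + e ^+ 2 - k ^+ 2 ->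
  (- k <= S * e - D * u) = (- (S * k + D * b) <= e).
Proof.
move=> D0 S0 DS k0 uk b0 b2.
have D1 : D <= 1 by have := sqr_ge0 S; nra.
have S2 : S ^+ 2 = 1 - D ^+ 2 by lra.
(* The two inequalities become [- Y <= Q] and [- X <= P], and [key] says that the squares differ
   equally. The identity for [S * P] excludes large [P] and [Q] of opposite signs. *)
set P := e + S * k; set X := D * b; set Q := S * e + k; set Y := D * - u.
have key : P ^+ 2 - X ^+ 2 = Q ^+ 2 - Y ^+ 2.
  by rewrite /P /X /Q /Y !exprMn b2 !sqrrD !exprMn S2; ring.
have X0 : 0 <= X by exact: mulr_ge0.
have Y0 : 0 <= Y by apply: mulr_ge0 => //; lra.
have Dk : D * k <= Y by apply: ler_wpM2l => //; lra.
have D2k : D ^+ 2 * k <= D * k.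
  by rewrite expr2 -mulrA ler_piMl// mulr_ge0.
have SP : S * P = Q - D ^+ 2 * k by rewrite /P /Q mulrDr mulrA -expr2 S2; ring.
rewrite (_ : (- k <= _) = (- Y <= Q)); last first.
  by rewrite /Y /Q; apply/idP/idP; lra.
rewrite (_ : (_ <= e) = (- X <= P)); last first.
  by rewrite /X /P; apply/idP/idP; lra.
apply/idP/idP => h; rewrite leNgt; apply/negP => h'.
- have PX : X ^+ 2 < P ^+ 2 by nra.
  have QY : Y < Q by nra.
  have : S * P <= 0 by rewrite mulr_ge0_le0//; lra.
  by lra.
- have QY : Y ^+ 2 < Q ^+ 2 by nra.
  have PX : X < P by nra.
  have : 0 <= S * P by rewrite mulr_ge0//; lra.
  have : 0 <= D ^+ 2 * k by rewrite mulr_ge0// sqr_ge0.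
  by lra.
Qed.

Lemma stretch_leftP D S k u e : 0 <= D -> 0 <= S -> D ^+ 2 + S ^+ 2 = 1 ->
  0 <= k -> u <= - k -> - k <= S * e - D * u ->
  (stretch D S k u e).1 <= - k /\
  (stretch D S k u e).1 ^+ 2 + (stretch D S k u e).2 ^+ 2 = u ^+ 2 + e ^+ 2.
Proof.
move=> D0 S0 DS k0 uk h; rewrite stretch_left//.
have := left_radius e k0 uk; set b := Num.sqrt _ => -[b0 b2 be eb].
move: h; rewrite (left_region (e := e) D0 S0 DS k0 uk b0 b2) => h.
set e' := e - _ => /=.
have e'b : - b <= e' <= b.
  by rewrite /e'; have [|] := leP 0 (b - e - 2 * (S * k + D * b)); lra.
have r2 : k ^+ 2 <= u ^+ 2 + e ^+ 2 - e' ^+ 2.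
  suff : e' ^+ 2 <= b ^+ 2 by lra.
  by rewrite -ler_sqrt ?sqr_ge0// !sqrtr_sqr (ger0_norm b0) ler_norml.
split; last by rewrite sqrrN sqr_sqrtr ?subrK//; apply: le_trans r2; exact: sqr_ge0.
by rewrite lerN2 -[leLHS](ger0_norm k0) -sqrtr_sqr ler_wsqrtr.
Qed.

Lemma stretch_norm D S k u e : 0 <= D -> 0 <= S -> D ^+ 2 + S ^+ 2 = 1 ->
  0 <= k -> - k <= S * e - D * u ->
  (stretch D S k u e).1 ^+ 2 + (stretch D S k u e).2 ^+ 2 = u ^+ 2 + e ^+ 2.
Proof.
move=> D0 S0 DS k0 h; have [ku|/ltW uk] := leP (- k) u.
  by rewrite stretch_right.
by have [] := stretch_leftP D0 S0 DS k0 uk h.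
Qed.

(** With [stretch_surj] this identifies the image: the forbidden half-plane has shrunk to the wedge
    where both alternatives fail. *)
Lemma stretch_target D S k u e : 0 <= D -> 0 <= S -> D ^+ 2 + S ^+ 2 = 1 ->
  0 <= k -> - k <= S * e - D * u ->
  (stretch D S k u e).1 <= - k \/
  - k <= S * (stretch D S k u e).2 - D * (stretch D S k u e).1.
Proof.
move=> D0 S0 DS k0 h; have [ku|/ltW uk] := leP (- k) u.
  by rewrite stretch_right//; right.
by have [] := stretch_leftP D0 S0 DS k0 uk h; left.
Qed.

Lemma stretch_inj D S k u1 e1 u2 e2 : 0 <= D -> 0 <= S ->
  D ^+ 2 + S ^+ 2 = 1 -> 0 <= k ->
  - k <= S * e1 - D * u1 -> - k <= S * e2 - D * u2 ->
  stretch D S k u1 e1 = stretch D S k u2 e2 -> u1 = u2 /\ e1 = e2.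
Proof.
move=> D0 S0 DS k0 h1 h2 E.
have left : u1 <= - k -> u2 <= - k -> u1 = u2 /\ e1 = e2.
  move=> uk1 uk2.
  have N : u1 ^+ 2 + e1 ^+ 2 = u2 ^+ 2 + e2 ^+ 2.
    by rewrite -(stretch_norm D0 S0 DS k0 h1) E stretch_norm.
  move: E; rewrite !stretch_left// N => -[_]; set b := Num.sqrt _ => eE.
  have {}eE : e1 = e2.
    move: eE; have [|] := leP 0 (b - e1 - 2 * (S * k + D * b));
    have [|] := leP 0 (b - e2 - 2 * (S * k + D * b)); lra.
  split=> //; move: N; rewrite eE => /addIr/eqP; rewrite eqf_sqr => /orP[/eqP//|].
  by move=> /eqP; lra.
have [ku1|/ltW uk1] := leP (- k) u1; have [ku2|/ltW uk2] := leP (- k) u2.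
- by move: E; rewrite !stretch_right// => -[].
- by apply: left => //; have [] := stretch_leftP D0 S0 DS k0 uk2 h2;
    rewrite -E stretch_right.
- by apply: left => //; have [] := stretch_leftP D0 S0 DS k0 uk1 h1;
    rewrite E stretch_right.
- exact: left.
Qed.

Lemma stretch_surj D S k u e : 0 <= D -> 0 <= S -> D ^+ 2 + S ^+ 2 = 1 ->
  0 <= k -> u <= - k \/ - k <= S * e - D * u ->
  exists u0 e0, - k <= S * e0 - D * u0 /\ stretch D S k u0 e0 = (u, e).
Proof.
move=> D0 S0 DS k0 h; have [ku|ku] := boolP ((- k <= u) && (- k <= S * e - D * u)).
  by exists u, e; case/andP: ku => ? ?; rewrite stretch_right.
have {}uk : u <= - k.
  by move: ku; case: h => // ->; rewrite andbT -ltNge => /ltW.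
have := left_radius e k0 uk; set b := Num.sqrt _ => -[b0 b2 be eb].
(* The second argument inverts the piece of slope 2, [e = 2 * e0 - b + 2 * (S * k + D * b)]; the
   maximum selects the piece that applies. *)
pose e0 := Num.max e ((e + b) / 2 - (S * k + D * b)).
have Sk0 : 0 <= S * k by exact: mulr_ge0.
have Db0 : 0 <= D * b by exact: mulr_ge0.
have e0b : [/\ - b <= e0, e0 <= b & - (S * k + D * b) <= e0].
  by rewrite /e0; have [|] := leP e ((e + b) / 2 - (S * k + D * b)); split; lra.
case: e0b => be0 e0b be0'.
pose r := u ^+ 2 + e ^+ 2 - e0 ^+ 2.
have r2 : k ^+ 2 <= r.
  rewrite /r; suff : e0 ^+ 2 <= b ^+ 2 by lra.
  by rewrite -ler_sqrt ?sqr_ge0// !sqrtr_sqr (ger0_norm b0) ler_norml be0.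
have rE : Num.sqrt r ^+ 2 = r.
  by rewrite sqr_sqrtr//; apply: le_trans r2; exact: sqr_ge0.
have kr : - Num.sqrt r <= - k.
  by rewrite lerN2 -[leLHS](ger0_norm k0) -sqrtr_sqr ler_wsqrtr.
have N : (- Num.sqrt r) ^+ 2 + e0 ^+ 2 = u ^+ 2 + e ^+ 2.
  by rewrite sqrrN rE /r subrK.
exists (- Num.sqrt r), e0; split.
  by rewrite (left_region D0 S0 DS k0 kr b0)// N.
rewrite stretch_left// N -/b.
have -> : e0 - Num.max 0 (b - e0 - 2 * (S * k + D * b)) = e.
  rewrite /e0; have [|] := leP e ((e + b) / 2 - (S * k + D * b)) => h1;
  [have [|] := leP 0 (b - ((e + b) / 2 - (S * k + D * b)) - 2 * (S * k + D * b))
  |have [|] := leP 0 (b - e - 2 * (S * k + D * b))]; lra.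
by rewrite addrK sqrtr_sqr ler0_norm ?opprK//; lra.
Qed.

End stretch.

Lemma cont_stretch (R : realType) (T : topologicalType) (p : T)
    (D S k u e : T -> R) :
  continuous_at p D -> continuous_at p S -> continuous_at p k ->
  continuous_at p u -> continuous_at p e ->
  continuous_at p (fun q => (stretch (D q) (S q) (k q) (u q) (e q)).1) /\
  continuous_at p (fun q => (stretch (D q) (S q) (k q) (u q) (e q)).2).
Proof.
move=> Dc Sc kc uc ec.
have c2 : continuous_at p (fun=> 2 : R) by exact: cont_cst.
have c0 : continuous_at p (fun=> 0 : R) by exact: cont_cst.
have u1c := cont_min uc (contN kc).
have r2c := contD (contX (n := 2) u1c) (contX (n := 2) ec).
have bc := cont_sqrt (contD r2c (contN (contX (n := 2) kc))).
have ec' := contD ec (contN (cont_max c0 (contD (contD bc (contN ec))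
  (contN (contM c2 (contD (contM Sc kc) (contM Dc bc))))))).
split; last exact: ec'.
exact: (contD (contD (cont_max uc (contN kc)) kc)
  (contN (cont_sqrt (contD r2c (contN (contX (n := 2) ec')))))).
Qed.

Opaque stretch.

(** * The step as a rotation of the stretched plane *)

Section step.
Context (R : rcfType).
Implicit Types (c k z x w : R).

Definition sn c : R := Num.sqrt (1 - c ^+ 2).

(* With [c = cos a] and [sn c = sin a], reflect by the double angle, stretch, and
   rotate back, so that without the stretching the result would be
   [(c z + s x, s z - c x)]. *)
Definition step c k z x : R * R :=
  let s := sn c in let D := s ^+ 2 - c ^+ 2 in let S := 2 * c * s in
  let p := stretch D S k (S * x - D * z) (S * z + D * x) in
  (c * p.1 + s * p.2, c * p.2 - s * p.1).

(* The image under [step c k] of the half-plane [- k <= z] is the set of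
   all [(w, z')] with [- next c k w <= z']. *)
Definition next c k w : R := `|k + c * w| / sn c.

(* [c] is the cosine of an angle between 45 and 90 degrees. *)
Definition angle c := 0 <= c /\ 2 * c ^+ 2 <= 1.

Lemma angleP c : angle c -> [/\ 0 < sn c, c ^+ 2 + sn c ^+ 2 = 1,
  0 <= sn c ^+ 2 - c ^+ 2, 0 <= 2 * c * sn c &
  (sn c ^+ 2 - c ^+ 2) ^+ 2 + (2 * c * sn c) ^+ 2 = 1].
Proof.
move=> [c0 c1]; have s0 : 0 < sn c by rewrite sqrtr_gt0; lra.
have s2 : sn c ^+ 2 = 1 - c ^+ 2 by rewrite sqr_sqrtr; lra.
split=> //; rewrite ?s2; [lra|lra| |].
  by apply: mulr_ge0; [exact: mulr_ge0|exact: ltW].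
by rewrite !exprMn s2; ring.
Qed.

(** In the reflected coordinates [- k <= z] becomes the half-plane on which [stretch] is studied. *)
Lemma rot_source c z x : angle c ->
  let D := sn c ^+ 2 - c ^+ 2 in let S := 2 * c * sn c in
  S * (S * z + D * x) - D * (S * x - D * z) = z.
Proof.
move=> /angleP[_ _ _ _ DS] D S.
by transitivity ((D ^+ 2 + S ^+ 2) * z); [ring|rewrite DS mul1r].
Qed.

Lemma rot_norm c z x : angle c ->
  let D := sn c ^+ 2 - c ^+ 2 in let S := 2 * c * sn c in
  (S * x - D * z) ^+ 2 + (S * z + D * x) ^+ 2 = z ^+ 2 + x ^+ 2.
Proof.
move=> /angleP[_ _ _ _ DS] D S.
transitivity ((D ^+ 2 + S ^+ 2) * (z ^+ 2 + x ^+ 2)); first by ring.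
by rewrite DS mul1r.
Qed.

Lemma step_norm c k z x : angle c -> 0 <= k -> - k <= z ->
  (step c k z x).1 ^+ 2 + (step c k z x).2 ^+ 2 = z ^+ 2 + x ^+ 2.
Proof.
move=> ac k0 kz; have [s0 cs D0 S0 DS] := angleP ac.
rewrite /step -[RHS](rot_norm z x ac) -[RHS](stretch_norm D0 S0 DS k0); last first.
  by rewrite rot_source.
case: (stretch _ _ _ _ _) => p q /=.
transitivity ((c ^+ 2 + sn c ^+ 2) * (p ^+ 2 + q ^+ 2)); first by ring.
by rewrite cs mul1r.
Qed.

Lemma next_ge0 c k w : 0 <= next c k w.
Proof. by rewrite divr_ge0 ?sqrtr_ge0. Qed.

(** After rotating back, the alternatives of [stretch_target] read [k + c * w <= sn c * z'] and
    [- (k + c * w) <= sn c * z']. One of them holds exactly when [- next c k w <= z']. *)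
Lemma step_ge c k z x : angle c -> 0 <= k -> - k <= z ->
  - next c k (step c k z x).1 <= (step c k z x).2.
Proof.
move=> ac k0 kz; have [s0 cs D0 S0 DS] := angleP ac.
rewrite /next -mulNr ler_pdivrMr// /step /=.
have := rot_source z x ac; set D := _ - _ in D0 DS *; set S := 2 * c * sn c in S0 DS *.
move=> /= src; have := @stretch_target _ D S k (S * x - D * z) (S * z + D * x) D0 S0 DS k0.
rewrite src => /(_ kz); case: (stretch _ _ _ _ _) => p q /= h.
set a := k + _; set y := _ * sn c.
suff : y >= a \/ y >= - a.
  by move=> ya; rewrite lerNl ler_normr; apply/orP; case: ya => ya; [right|left]; lra.
have e1 : y - a = - k - p * (c ^+ 2 + sn c ^+ 2) by rewrite /y /a; ring.
have e2 : y + a = k + (S * q - D * p).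
  by rewrite /y /a /S /D; ring.
case: h => h; [left|right]; move: e1 e2; rewrite cs mulr1; lra.
Qed.

Lemma step_inj c k z1 x1 z2 x2 : angle c -> 0 <= k -> - k <= z1 -> - k <= z2 ->
  step c k z1 x1 = step c k z2 x2 -> z1 = z2 /\ x1 = x2.
Proof.
move=> ac k0 kz1 kz2; have [s0 cs D0 S0 DS] := angleP ac.
rewrite /step /=; set p1 := stretch _ _ _ _ _; set p2 := stretch _ _ _ _ _.
set D := _ - _ in D0 DS p1 p2 *; set S := 2 * c * sn c in S0 DS p1 p2 *.
move=> /= [E1 E2].
have lin (u v : R) : c * u + sn c * v = 0 -> c * v - sn c * u = 0 -> u = 0 /\ v = 0.
  move=> h1 h2; split.
  - rewrite -[LHS]mul1r -cs (_ : _ * u = c * (c * u + sn c * v) - sn c * (c * v - sn c * u)).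
      by rewrite h1 h2; ring.
    by ring.
  - rewrite -[LHS]mul1r -cs (_ : _ * v = sn c * (c * u + sn c * v) + c * (c * v - sn c * u)).
      by rewrite h1 h2; ring.
    by ring.
have [pE1 pE2] : p1.1 - p2.1 = 0 /\ p1.2 - p2.2 = 0.
  by apply: lin; [move: E1|move: E2];
    move: (p1.1) (p1.2) (p2.1) (p2.2) => a b a' b'; lra.
have pE : p1 = p2.
  by apply/eqP; rewrite eqE /= -subr_eq0 pE1 eqxx /= -subr_eq0 pE2 eqxx.
have [|| u12 e12] := stretch_inj D0 S0 DS k0 _ _ pE; rewrite ?rot_source//.
have src1 := rot_source z1 x1 ac; have src2 := rot_source z2 x2 ac.
rewrite /= -/D -/S in src1 src2; split; first by rewrite -src1 -src2 u12 e12.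
rewrite -[LHS]mul1r -[RHS]mul1r -DS.
rewrite (_ : _ * x1 = S * (S * x1 - D * z1) + D * (S * z1 + D * x1)); last by ring.
by rewrite u12 e12; ring.
Qed.

Lemma step_surj c k w z' : angle c -> 0 <= k -> - next c k w <= z' ->
  exists z x, - k <= z /\ step c k z x = (w, z').
Proof.
move=> ac k0; have [s0 cs D0 S0 DS] := angleP ac.
rewrite /next -mulNr ler_pdivrMr//; set D := _ - _ in D0 DS.
set S := 2 * c * sn c in S0 DS => h.
pose u := c * w - sn c * z'; pose e := sn c * w + c * z'.
have [|u0 [e0 [src pE]]] := @stretch_surj _ D S k u e D0 S0 DS k0.
  have e1 : S * e - D * u = (c * w + z' * sn c) * (c ^+ 2 + sn c ^+ 2).
    by rewrite /S /e /D /u; ring.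
  move: h; rewrite e1 cs mulr1 /u [sn c * z']mulrC.
  have [kw|kw] := leP 0 (k + c * w).
    by rewrite (ger0_norm kw) => h; right; lra.
  by rewrite (ltr0_norm kw) => h; left; lra.
exists (S * e0 - D * u0), (S * u0 + D * e0); split=> //.
rewrite /step -/D -/S.
have -> : S * (S * u0 + D * e0) - D * (S * e0 - D * u0) = u0.
  by rewrite -[RHS]mul1r -DS; ring.
have -> : S * (S * e0 - D * u0) + D * (S * u0 + D * e0) = e0.
  by rewrite -[RHS]mul1r -DS; ring.
rewrite pE /= /u /e; congr pair; rewrite -[RHS]mul1r -cs; ring.
Qed.

Lemma step0 c k : angle c -> 0 <= k -> step c k 0 0 = (0, 0).
Proof.
move=> ac k0; have [s0 cs D0 S0 DS] := angleP ac.
by rewrite /step !mulr0 subr0 addr0 stretch_right//= ?oppr_le0// !mulr0 ?subr0 ?addr0 ?oppr_le0.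
Qed.

(** At 90 degrees [D = 1] and [S = 0], so the correction in [stretch] is never positive and no point
    of the half-plane moves. *)
Lemma step_swap k z x : 0 <= k -> - k <= z -> step 0 k z x = (x, z).
Proof.
move=> k0 kz; have s1 : sn 0 = 1 by rewrite /sn expr0n subr0 sqrtr1.
rewrite /step /= s1 (_ : 1 ^+ 2 - 0 ^+ 2 = 1); last by ring.
rewrite (_ : 2 * 0 * 1 = 0); last by ring.
rewrite (_ : 0 * x - 1 * z = - z); last by ring.
rewrite (_ : 0 * z + 1 * x = x); last by ring.
have D1 : 1 ^+ 2 + 0 ^+ 2 = 1 :> R by rewrite expr1n expr0n addr0.
have src : - k <= 0 * x - 1 * - z by rewrite mul0r sub0r mul1r opprK.
suff E : stretch 1 0 k (- z) x = (- z, x).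
  by rewrite E /=; congr pair; ring.
have [zk|kz'] := leP z k; first by rewrite stretch_right// ?lerN2.
have zk : - z <= - k by rewrite lerN2 ltW.
rewrite stretch_left//; have [b0 b2 bx _] := left_radius x k0 zk.
have -> : x - Num.max 0 (Num.sqrt ((- z) ^+ 2 + x ^+ 2 - k ^+ 2) - x - 2 *
    (0 * k + 1 * Num.sqrt ((- z) ^+ 2 + x ^+ 2 - k ^+ 2))) = x.
  by rewrite max_l ?subr0//; lra.
by rewrite addrK sqrtr_sqr normrN ger0_norm//; lra.
Qed.

(** Rational bounds on [1 / sqrt 2], which keep the later estimates within reach of linear
    arithmetic. *)
Lemma half_angle c : 0 <= c -> 2 * c ^+ 2 = 1 ->
  [/\ angle c, sn c = c, 7 / 10 <= c & c <= 5 / 7].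
Proof.
move=> c0 c2; split; [by rewrite /angle c2| |nra|nra].
by rewrite /sn (_ : 1 - c ^+ 2 = c ^+ 2) ?sqrtr_sqr ?ger0_norm//; lra.
Qed.

Lemma step_half c k z x : 0 <= c -> 2 * c ^+ 2 = 1 ->
  step c k z x = (c * ((stretch 0 1 k x z).1 + (stretch 0 1 k x z).2),
                  c * ((stretch 0 1 k x z).2 - (stretch 0 1 k x z).1)).
Proof.
move=> c0 c2; have [_ sc _ _] := half_angle c0 c2.
rewrite /step sc subrr (_ : 2 * c * c = 1); last by rewrite -mulrA -expr2.
by rewrite !mul1r !mul0r subr0 addr0; congr pair; ring.
Qed.

Lemma step_linear c k z x : 0 <= c -> 2 * c ^+ 2 = 1 -> 0 <= k -> - k <= z ->
  - k <= x -> step c k z x = (c * (x + z), c * (z - x)).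
Proof.
move=> c0 c2 k0 kz kx; rewrite step_half// stretch_right// ?expr1n ?expr0n ?add0r//.
by rewrite mul1r mul0r subr0.
Qed.

Lemma half_leftP k x z : 0 <= k -> x <= - k -> - k <= z ->
  exists b u e, [/\ stretch 0 1 k x z = (u, e), [/\ 0 <= b,
    b ^+ 2 = x ^+ 2 + z ^+ 2 - k ^+ 2, u <= - k &
    u ^+ 2 + e ^+ 2 = x ^+ 2 + z ^+ 2] & e = z - Num.max 0 (b - z - 2 * k)].
Proof.
move=> k0 xk kz; have D1 : 0 ^+ 2 + 1 ^+ 2 = 1 :> R by rewrite expr1n expr0n add0r.
have src : - k <= 1 * z - 0 * x by rewrite mul1r mul0r subr0.
have [uk N] := stretch_leftP (lexx 0) ler01 D1 k0 xk src.
have [b0 b2 _ _] := left_radius z k0 xk.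
exists (Num.sqrt (x ^+ 2 + z ^+ 2 - k ^+ 2)).
exists (stretch 0 1 k x z).1, (stretch 0 1 k x z).2; split.
- exact: surjective_pairing.
- by split.
- by rewrite stretch_left//= mul1r mul0r addr0.
Qed.

(** Makes [z_n + k_n] nondecreasing along orbits. Multiplied by [c], the right side becomes [m],
    which dominates both [e + k] and [- u - k]. *)
Lemma step_expand c k z x : 0 <= c -> 2 * c ^+ 2 = 1 -> 0 <= k -> - k <= z ->
  z + k <= (step c k z x).2 + next c k (step c k z x).1.
Proof.
move=> c0 c2 k0 kz; have [_ sc c7 c34] := half_angle c0 c2.
have cgt0 : 0 < c by lra.
rewrite -(ler_pM2l cgt0) [leRHS]mulrDr /next sc [c * (_ / c)]mulrC divfK ?gt_eqF//.
have [kx|/ltW xk] := leP (- k) x.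
  rewrite step_linear//= !mulrA -expr2 (_ : c ^+ 2 = 1 / 2); last by lra.
  have : 0 <= (z + k) * (1 - c) by apply: mulr_ge0; lra.
  by have := ler_norm (k + 1 / 2 * (x + z)); lra.
have [b [u [e [E [b0 b2 uk N] eE]]]] := half_leftP k0 xk kz.
rewrite step_half// E /= !mulrA -expr2 (_ : c ^+ 2 = 1 / 2); last by lra.
set m := 1 / 2 * (e - u) + _.
have ms : e + k <= m by have := ler_norm (k + 1 / 2 * (u + e)); rewrite /m; lra.
have my : - u - k <= m.
  by have := ler_norm (- (k + 1 / 2 * (u + e))); rewrite normrN /m; lra.
have m0 : 0 <= m by lra.
clearbody m.
have [zE|[zE]] : z = e \/ (2 * (z + k) = e + b).
  by move: eE; have [|] := leP 0 (b - z - 2 * k); [right|left]; lra.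
- subst z; suff : (e + k) * c <= m by lra.
  by apply: le_trans ms; rewrite ler_piMr//; lra.
(* With [2 * (z + k) = e + b] this yields [z + k <= 7 / 5 * m], and [c <= 5 / 7] does the rest. *)
- suff bm : b <= 28 / 10 * m - e.
    have : 0 <= (7 / 5 * m - (z + k)) * c by apply: mulr_ge0; lra.
    have : 0 <= m * (5 / 7 - c) by apply: mulr_ge0; lra.
    by lra.
  rewrite -(ler_pXn2r (ltn0Sn 1)) ?nnegrE//; last by lra.
  have b2' : b ^+ 2 = e ^+ 2 + u ^+ 2 - k ^+ 2 by rewrite b2 -N; ring.
  rewrite b2'; nra.
Qed.

(** Without stretching, [z] is a combination of [x] and the output. With it, if [r < z], then [e] is
    within [r] of [z] and [u] is close to [- e], so [x ^+ 2 + z ^+ 2 = u ^+ 2 + e ^+ 2] is nearly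
    [2 * z ^+ 2], which forces [z] to be small. *)
Lemma step_small c k z x r : 0 <= c -> 2 * c ^+ 2 = 1 -> 0 <= k -> - k <= z ->
  `|z| <= 1 -> r <= 1 -> `|x| <= r -> `|(step c k z x).1| <= r ->
  z ^+ 2 <= 10 * r.
Proof.
move=> c0 c2 k0 kz z1 r1 xr; have [_ sc c7 c57] := half_angle c0 c2.
have r0 : 0 <= r by exact: le_trans xr.
move: z1 xr; rewrite !ler_norml => /andP[z1 z2] /andP[x1 x2].
have [kx|/ltW xk] := leP (- k) x.
  rewrite step_linear//= => /andP[w1 w2].
  have zle : z <= 3 * r.
    rewrite leNgt; apply/negP => h.
    have : 0 <= (x + z) * (c - 7 / 10) by apply: mulr_ge0; lra.
    by lra.
  have zge : - (3 * r) <= z.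
    rewrite leNgt; apply/negP => h.
    have : 0 <= (- x - z) * (c - 7 / 10) by apply: mulr_ge0; lra.
    by lra.
  have : 0 <= (3 * r - z) * (3 * r + z) by apply: mulr_ge0; lra.
  have : 0 <= r * (1 - r) by apply: mulr_ge0; lra.
  by lra.
have [b [u [e [E [b0 b2 uk N] eE]]]] := half_leftP k0 xk kz.
rewrite step_half// E /=; set w := c * _ => /andP[w1 w2].
have rr : 0 <= r * (1 - r) by apply: mulr_ge0; lra.
have [zr|rz] := leP z r.
  have : 0 <= (r - z) * (r + z) by apply: mulr_ge0; lra.
  by lra.
have bz : b <= z - x.
  rewrite -(ler_pXn2r (ltn0Sn 1)) ?nnegrE//; last by lra.
  rewrite b2; have : 0 <= z * - x by apply: mulr_ge0; lra.
  by have := sqr_ge0 k; lra.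
have ze : z - r <= e.
  by rewrite eE; have [|] := leP 0 (b - z - 2 * k); lra.
have ez : e <= z by rewrite eE; have [|] := leP 0 (b - z - 2 * k); lra.
have uE : u = 2 * c * w - e.
  by rewrite /w mulrA -[2 * c * c]mulrA -expr2 c2 mul1r addrK.
clearbody w.
have ce : 0 <= (10 / 7 - 2 * c) * e by apply: mulr_ge0; lra.
have we : w * (2 * c * e) <= r * (10 / 7).
  have : 0 <= (r - w) * (2 * c * e) by rewrite !mulr_ge0//; lra.
  have : 0 <= r * (10 / 7 - 2 * c * e) by apply: mulr_ge0; lra.
  by lra.
have N' : 2 * e ^+ 2 = x ^+ 2 + z ^+ 2 + 2 * (w * (2 * c * e)) - 2 * w ^+ 2.
  have key : (2 * c * w - e) ^+ 2 + e ^+ 2 =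
      2 * w ^+ 2 * (2 * c ^+ 2) - 2 * (w * (2 * c * e)) + 2 * e ^+ 2 by ring.
  by move: N; rewrite uE key c2; lra.
have xx : 0 <= (r - x) * (r + x) by apply: mulr_ge0; lra.
have ww := sqr_ge0 w; have r2 := sqr_ge0 r.
have zz : 0 <= (e - (z - r)) * (e + (z - r)) by apply: mulr_ge0; lra.
have zr : 0 <= (1 - z) * r by apply: mulr_ge0; lra.
lra.
Qed.

End step.

Lemma cont_step (R : realType) (T : topologicalType) (p : T)
    (c k z x : T -> R) :
  continuous_at p c -> continuous_at p k -> continuous_at p z ->
  continuous_at p x ->
  continuous_at p (fun q => (step (c q) (k q) (z q) (x q)).1) /\
  continuous_at p (fun q => (step (c q) (k q) (z q) (x q)).2).
Proof.
move=> cc kc zc xc.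
have sc : continuous_at p (fun q => sn (c q)).
  exact: (cont_sqrt (contD (@cont_cst _ _ p 1) (contN (contX (n := 2) cc)))).
pose D q := sn (c q) ^+ 2 - c q ^+ 2.
pose S q := 2 * c q * sn (c q).
have Dc : continuous_at p D.
  by apply: contD; [|apply: contN]; exact: contX.
have Sc : continuous_at p S.
  by apply: contM => //; apply: contM => //; exact: cont_cst.
have uc : continuous_at p (fun q => S q * x q - D q * z q).
  by apply: contD; [|apply: contN]; exact: contM.
have ec : continuous_at p (fun q => S q * z q + D q * x q).
  by apply: contD; exact: contM.
have [c1 c2] := cont_stretch Dc Sc kc uc ec.
split; first by apply: (contD (contM cc c1) (contM sc c2)).
by apply: (contD (contM cc c2) (contN (contM sc c1))).
Qed.

Lemma cont_next (R : realType) (T : topologicalType) (p : T) (c k w : T -> R) :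
  sn (c p) != 0 -> continuous_at p c -> continuous_at p k ->
  continuous_at p w -> continuous_at p (fun q => next (c q) (k q) (w q)).
Proof.
move=> s0 cc kc wc; rewrite /next; apply: contM; first by cont.
by apply: contV => //; rewrite /sn; cont.
Qed.

Opaque step.

(** * Orbits of the carry *)

Section orbits.
Context (R : realType).
Implicit Types (c y w : nat -> R) (s : R * R).

Fixpoint orb c y s n : R * R :=
  if n is n'.+1 then
    let t := orb c y s n' in
    let p := step (c n') t.2 t.1 (y n') in (p.2, next (c n') t.2 p.1)
  else s.

Definition out c y s n : R :=
  (step (c n) (orb c y s n).2 (orb c y s n).1 (y n)).1.

Lemma orbS c y s n : orb c y s n.+1 =
  let t := orb c y s n in
  let p := step (c n) t.2 t.1 (y n) in (p.2, next (c n) t.2 p.1).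
Proof. by []. Qed.

Lemma orbS1 c y s n : (orb c y s n.+1).1 =
  (step (c n) (orb c y s n).2 (orb c y s n).1 (y n)).2.
Proof. by []. Qed.

Lemma orb_shift c y s n :
  orb c y s n.+1 = orb (fun i => c i.+1) (fun i => y i.+1) (orb c y s 1) n.
Proof. by elim: n => // n ih; rewrite [LHS]orbS ih. Qed.

Lemma out_shift c y s n :
  out c y s n.+1 = out (fun i => c i.+1) (fun i => y i.+1) (orb c y s 1) n.
Proof. by rewrite /out orb_shift. Qed.

Lemma orb_inv c y s n : (forall i, angle (c i)) -> 0 <= s.2 -> - s.2 <= s.1 ->
  0 <= (orb c y s n).2 /\ - (orb c y s n).2 <= (orb c y s n).1.
Proof.
move=> ac k0 kz; elim: n => // n [ih1 ih2] /=.
by split; [exact: next_ge0|exact: step_ge].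
Qed.

Lemma orb_energy c y s n : (forall i, angle (c i)) -> 0 <= s.2 -> - s.2 <= s.1 ->
  \sum_(i < n) out c y s i ^+ 2 + (orb c y s n).1 ^+ 2 =
  s.1 ^+ 2 + \sum_(i < n) y i ^+ 2.
Proof.
move=> ac k0 kz; elim: n => [|n ih]; first by rewrite !big_ord0 addrC.
rewrite !big_ord_recr orbS/= [RHS]addrA -ih -[LHS]addrA -[RHS]addrA.
congr (_ + _).
by have [i1 i2] := @orb_inv c y s n ac k0 kz; exact: step_norm.
Qed.

Lemma orb_next c y s n :
  (orb c y s n.+1).2 = next (c n) (orb c y s n).2 (out c y s n).
Proof. by []. Qed.

(** The bounds are functions of the outputs, so two orbits with equal outputs face the same
    forbidden regions. *)
Lemma orb_out_eq c y y' z z' k n :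
  (forall i, out c y (z, k) i = out c y' (z', k) i) ->
  (orb c y (z, k) n).2 = (orb c y' (z', k) n).2.
Proof. by move=> E; elim: n => // n ih; rewrite !orb_next ih E. Qed.

Definition vanishing (a : nat -> R) : Prop :=
  forall r, 0 < r -> exists N, forall n, (N <= n)%N -> `|a n| <= r.

Lemma vanishing_summable (a : nat -> R) (B : R) :
  (forall n, \sum_(i < n) a i ^+ 2 <= B) -> vanishing a.
Proof.
move=> aB r r0.
have cv : cvgn (series (fun i => a i ^+ 2)).
  apply: nondecreasing_is_cvgn.
    apply/nondecreasing_seqP => n; rewrite /series /= big_nat_recr//=.
    by rewrite lerDl sqr_ge0.
  by exists B => _ [n _ <-]; rewrite /series /= big_mkord.
have /cvgrPdist_le/(_ (r ^+ 2) (exprn_gt0 2 r0)) := cvg_series_cvg_0 cv.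
move=> [N _ hN]; exists N => n Nn; have := hN n Nn.
rewrite /= sub0r normrN ger0_norm ?sqr_ge0// => h.
by rewrite -(ler_pXn2r (ltn0Sn 1)) ?nnegrE ?(ltW r0)// real_normK ?num_real.
Qed.

Lemma vanishingD (a b : nat -> R) :
  vanishing a -> vanishing b -> vanishing (fun n => a n + b n).
Proof.
move=> va vb r r0; have r20 : 0 < r / 2 by lra.
have [N hN] := va _ r20; have [M hM] := vb _ r20.
exists (maxn N M) => n; rewrite geq_max => /andP[Nn Mn].
by apply: le_trans (ler_normD _ _) _; have := hN _ Nn; have := hM _ Mn; lra.
Qed.

Lemma vanishingN (a : nat -> R) : vanishing a -> vanishing (fun n => - a n).
Proof.
move=> va r /va[N hN]; exists N => n /hN; by rewrite normrN.
Qed.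

Lemma vanishing_nondecreasing (a : nat -> R) N :
  (forall n, (N <= n)%N -> 0 <= a n /\ a n <= a n.+1) -> vanishing a ->
  forall n, (N <= n)%N -> a n = 0.
Proof.
move=> aN va n Nn; apply/le_anti; rewrite (aN n Nn).1 andbT.
apply/ler_addgt0Pr => r r0; rewrite add0r; have [M hM] := va r r0.
have mono k : a n <= a (n + k)%N.
  elim: k => [|k ih]; first by rewrite addn0.
  rewrite addnS; apply: le_trans ih _.
  by have [] := aN (n + k)%N (leq_trans Nn (leq_addr _ _)).
apply: le_trans (mono M) _; apply: le_trans (ler_norm _) _.
by apply: hM; exact: leq_addl.
Qed.

Definition half_eventually c := exists N, forall n, (N <= n)%N -> 2 * c n ^+ 2 = 1.

Section bounded_orbit.
Context (c y : nat -> R) (z k : R).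
Hypotheses (ac : forall i, angle (c i)) (hc : half_eventually c) (k0 : 0 <= k)
  (kz : - k <= z) (zy1 : forall n, z ^+ 2 + \sum_(i < n) y i ^+ 2 <= 1).

Lemma orb_vanishing_in : vanishing y.
Proof.
apply: (@vanishing_summable _ 1) => n; apply: le_trans (zy1 n).
by rewrite lerDr sqr_ge0.
Qed.

Lemma orb_in_le1 n : `|y n| <= 1.
Proof.
rewrite -(ler_pXn2r (ltn0Sn 1)) ?nnegrE// expr1n real_normK ?num_real//.
apply: le_trans (zy1 n.+1); rewrite big_ord_recr/= addrA lerDr.
by rewrite addr_ge0 ?sqr_ge0 ?sumr_ge0// => i _; rewrite sqr_ge0.
Qed.

Lemma orb_vanishing_out : vanishing (out c y (z, k)).
Proof.
apply: (@vanishing_summable _ 1) => n; apply: le_trans (zy1 n).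
by rewrite -(@orb_energy c y (z, k) n)// lerDl sqr_ge0.
Qed.

Lemma orb_le1 n : `|(orb c y (z, k) n).1| <= 1.
Proof.
rewrite -(ler_pXn2r (ltn0Sn 1)) ?nnegrE// expr1n real_normK ?num_real//.
apply: le_trans (zy1 n); rewrite -(@orb_energy c y (z, k) n)// lerDr.
by rewrite sumr_ge0// => i _; rewrite sqr_ge0.
Qed.

(** Bounded energy makes inputs and outputs vanish; once the angle is 45 degrees, [step_small]
    passes this on to the carry. *)
Lemma orb_vanishing : vanishing (fun n => (orb c y (z, k) n).1).
Proof.
move=> r r0; have [N hN] := hc.
pose q := Num.min 1 (r ^+ 2 / 10).
have q0 : 0 < q by rewrite lt_min ltr01 divr_gt0// exprn_gt0.
have [N1 h1] := orb_vanishing_in q0; have [N2 h2] := orb_vanishing_out q0.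
exists (maxn N (maxn N1 N2)) => n; rewrite !geq_max => /and3P[n0 n1 n2].
rewrite -(ler_pXn2r (ltn0Sn 1)) ?nnegrE ?(ltW r0)// real_normK ?num_real//.
have [i1 i2] := @orb_inv c y (z, k) n ac k0 kz.
apply: (@le_trans _ _ (10 * q)); last first.
  by rewrite mulrC -ler_pdivlMr// /q ge_min lexx orbT.
apply: (step_small _ (hN n n0) i1 i2 (orb_le1 n) _ (h1 n n1) (h2 n n2)).
  by case: (ac n).
by rewrite /q ge_min lexx.
Qed.

End bounded_orbit.

Lemma orb_unique c y y' z z' k :
  (forall i, angle (c i)) -> half_eventually c -> 0 <= k ->
  - k <= z -> (forall n, z ^+ 2 + \sum_(i < n) y i ^+ 2 <= 1) ->
  - k <= z' -> (forall n, z' ^+ 2 + \sum_(i < n) y' i ^+ 2 <= 1) ->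
  (forall n, out c y (z, k) n = out c y' (z', k) n) ->
  exists N, forall n, (N <= n)%N ->
    (orb c y (z, k) n).1 = (orb c y' (z', k) n).1.
Proof.
move=> ac [N0 hN0] k0 kz zy1 kz' zy1' E; have hc : half_eventually c by exists N0.
have vz := orb_vanishing ac hc k0 kz zy1.
have vz' := orb_vanishing ac hc k0 kz' zy1'.
have vw := orb_vanishing_out ac k0 kz zy1.
have kE n := orb_out_eq n E.
pose kk n := (orb c y (z, k) n).2; pose zz n := (orb c y (z, k) n).1.
pose zz' n := (orb c y' (z', k) n).1; pose ww := out c y (z, k).
have inv n : 0 <= kk n /\ - kk n <= zz n by exact: orb_inv.
have inv' n : - kk n <= zz' n by rewrite /kk kE; apply: (orb_inv _ _ _ _ _).2.
have kS n : kk n.+1 = next (c n) (kk n) (ww n) by [].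
have grow n r : (N0 <= n)%N -> `|ww n| <= r -> 7 / 5 * kk n - r <= kk n.+1.
  move=> n0 wr; have [a0 _] := ac n; have [k1 _] := inv n.
  have [_ sc c7 c57] := half_angle a0 (hN0 n n0).
  rewrite kS /next sc ler_pdivlMr; last by lra.
  apply: le_trans (ler_norm _).
  have : 0 <= (5 / 7 - c n) * kk n by apply: mulr_ge0; lra.
  have : 0 <= c n * (r + ww n).
    by apply: mulr_ge0 => //; move: wr; rewrite ler_norml => /andP[]; lra.
  lra.
(* Since [7 / 5 - 1 / 4 >= 1], the bound [1 <= kk n] will persist. *)
have [N1 hN1] := vw (1 / 4) ltac:(lra).
pose N := maxn N0 N1.
have NN0 n : (N <= n)%N -> (N0 <= n)%N by rewrite geq_max => /andP[].
have NN1 n : (N <= n)%N -> `|ww n| <= 1 / 4 by rewrite geq_max => /andP[_ /hN1].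
(* If [kk] reaches 1 it stays above every [|y n|], so the steps are linear and
   [z_n = c_n * (w_n + z_(n+1))]. The distance of the two carries is then nondecreasing in [n] and
   vanishing, hence 0. *)
have [[n1 [Nn1 kn1]]|small] := pselect (exists n, (N <= n)%N /\ 1 <= kk n).
  have k1 n : (n1 <= n)%N -> 1 <= kk n.
    elim: n => [|n ih]; first by rewrite leqn0 => /eqP <-.
    rewrite leq_eqVlt => /orP[/eqP <-//|n1n]; have kn := ih n1n.
    have nN : (N <= n)%N by exact: leq_trans Nn1 n1n.
    by have := grow _ _ (NN0 _ nN) (NN1 _ nN); lra.
  exists n1 => n n1n; apply/eqP; rewrite -subr_eq0 -normr_eq0; apply/eqP.
  apply: (vanishing_nondecreasing (N := n1) (a := fun n => `|zz n - zz' n|)) => //.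
    move=> n' n1n'; split=> //.
    have lin ys zs : (forall n, - kk n <= (orb c ys (zs, k) n).1) ->
        (forall n, kk n = (orb c ys (zs, k) n).2) -> `|ys n'| <= 1 ->
        (orb c ys (zs, k) n').1 =
        c n' * (out c ys (zs, k) n' + (orb c ys (zs, k) n'.+1).1).
      move=> kzs kks; rewrite ler_norml => /andP[y1 _].
      have [a0 _] := ac n'; have [kn0 _] := inv n'.
      have c2 := hN0 n' (NN0 _ (leq_trans Nn1 n1n')).
      rewrite orbS /out -kks step_linear//=; last by have := k1 _ n1n'; lra.
      by rewrite -[LHS]mul1r -c2; ring.
    rewrite /zz /zz' (lin y z (fun n => (inv n).2) (fun=> erefl)); last first.
      exact: (orb_in_le1 zy1).
    rewrite (lin y' z' inv' kE); last exact: (orb_in_le1 zy1').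
    rewrite E -mulrBr opprD addrACA subrr add0r normrM ger0_norm; last by case: (ac n').
    rewrite ler_piMl//; have [a0 _] := ac n'.
    have c2 := hN0 n' (NN0 _ (leq_trans Nn1 n1n')).
    by have [_ _ _ h] := half_angle a0 c2; apply: le_trans h _; lra.
  move=> r r0; have [M hM] := vanishingD vz (vanishingN vz') r0.
  by exists M => m /hM; rewrite normr_id.
have {}small n : (N <= n)%N -> kk n < 1.
  by move=> Nn; rewrite ltNge; apply/negP => kn; apply: small; exists n.
(* If [kk n] exceeded [r] once the outputs are below [r / 3], every step would add at least
   [7 / 5 * r - r / 3 - r = r / 15], and [kk] would reach 1. *)
have vk : vanishing kk.
  move=> r r0; have [M0 hM0] := vw (r / 3) ltac:(lra).
  exists (maxn N M0) => n; rewrite geq_max => /andP[Nn Mn].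
  rewrite ger0_norm; last by case: (inv n).
  rewrite leNgt; apply/negP => rk.
  have lin j : kk n + j%:R * (r / 15) <= kk (n + j)%N.
    elim: j => [|j ih]; first by rewrite mul0r addr0 addn0.
    rewrite addnS; apply: le_trans (grow _ (r / 3) _ _); last 2 first.
    - by apply: NN0; exact: leq_trans (leq_addr _ _).
    - by apply: hM0; exact: leq_trans (leq_addr _ _).
    have : 0 <= j%:R * (r / 15) by apply: mulr_ge0 => //; lra.
    rewrite (_ : j.+1%:R * (r / 15) = j%:R * (r / 15) + r / 15).
      by lra.
    by rewrite -natr1 mulrDl mul1r.
  have [j jr] : exists j : nat, 1 <= j%:R * (r / 15).
    exists (Num.bound (15 / r)); rewrite -ler_pdivrMr; last by lra.
    rewrite mul1r invf_div; apply/ltW/archi_boundP.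
    by apply: divr_ge0; lra.
  have := small (n + j)%N (leq_trans Nn (leq_addr _ _)).
  have := lin j; lra.
(* By [step_expand] the sum is nonnegative, nondecreasing and vanishing, so both carries equal
   [- kk n]. *)
have zero zs ys : (forall n, - kk n <= (orb c ys (zs, k) n).1) ->
    (forall n, kk n = (orb c ys (zs, k) n).2) ->
    vanishing (fun n => (orb c ys (zs, k) n).1) ->
    forall n, (N <= n)%N -> (orb c ys (zs, k) n).1 + kk n = 0.
  move=> kzs kks vzs; apply: vanishing_nondecreasing; last exact: vanishingD.
  move=> n Nn; split; first by rewrite -lerBlDr sub0r.
  have [a0 _] := ac n; have [k1 _] := inv n.
  rewrite !kks; apply: step_expand => //; [exact/hN0/NN0|by rewrite -kks|].
  by rewrite -kks.
exists N => n Nn.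
have := zero z y (fun n => (inv n).2) (fun=> erefl) vz n Nn.
have := zero z' y' inv' kE vz' n Nn.
lra.
Qed.

(** From an index where the carries agree, [step_inj] recovers inputs and earlier carries one step
    at a time. *)
Lemma orb_inj c y y' z z' k :
  (forall i, angle (c i)) -> half_eventually c -> 0 <= k ->
  - k <= z -> (forall n, z ^+ 2 + \sum_(i < n) y i ^+ 2 <= 1) ->
  - k <= z' -> (forall n, z' ^+ 2 + \sum_(i < n) y' i ^+ 2 <= 1) ->
  (forall n, out c y (z, k) n = out c y' (z', k) n) ->
  z = z' /\ y =1 y'.
Proof.
move=> ac hc k0 kz zy1 kz' zy1' E.
have [N hN] := orb_unique ac hc k0 kz zy1 kz' zy1' E.
have kE n := orb_out_eq n E.
have back n : (orb c y (z, k) n.+1).1 = (orb c y' (z', k) n.+1).1 ->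
    (orb c y (z, k) n).1 = (orb c y' (z', k) n).1 /\ y n = y' n.
  move=> En; have [k1 z1] := @orb_inv c y (z, k) n ac k0 kz.
  have [_ z1'] := @orb_inv c y' (z', k) n ac k0 kz'.
  apply: (@step_inj _ (c n) (orb c y (z, k) n).2) => //; first by rewrite kE.
  apply/eqP; rewrite eqE /=; apply/andP; split.
    by have /eqP := E n; rewrite /out -kE.
  by move/eqP: En; rewrite !orbS /= -kE.
have all n : (orb c y (z, k) n).1 = (orb c y' (z', k) n).1.
  have : forall j, (orb c y (z, k) (N - j)).1 = (orb c y' (z', k) (N - j)).1.
    elim=> [|j ih]; first by rewrite subn0 hN.
    have [jN|Nj] := ltnP j N; last first.
      by rewrite subnS; move: Nj ih; rewrite -subn_eq0 => /eqP ->.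
    by apply: (back _ _).1; rewrite -subSn// subSS.
  move=> h; have [nN|/ltnW/hN//] := leqP n N.
  by have := h (N - n)%N; rewrite subKn.
split; first exact: (all 0%N).
by move=> n; exact: (back n (all n.+1)).2.
Qed.

(** Bounds are determined forwards by the outputs, carries backwards from 0. The induction therefore
    passes the new bound to the tail and solves the first step last. *)
Lemma orb_surj N c w k : (forall i, angle (c i)) -> 0 <= k ->
  (forall n, (N <= n)%N -> w n = 0) ->
  exists z y, [/\ - k <= z, forall n, (N <= n)%N -> y n = 0,
    forall n, out c y (z, k) n = w n &
    forall n, (N <= n)%N -> (orb c y (z, k) n).1 = 0].
Proof.
elim: N c w k => [|N ih] c w k ac k0 w0.
  have o0 n : (orb c (fun=> 0) (0, k) n).1 = 0.
    elim: n => // n h; rewrite orbS1 h step0//.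
    by have [] := @orb_inv c (fun=> 0) (0, k) n ac k0; rewrite //= oppr_le0.
  exists 0, (fun=> 0); split=> //; first by rewrite oppr_le0.
  move=> n; rewrite /out o0 step0 ?w0//.
  by have [] := @orb_inv c (fun=> 0) (0, k) n ac k0; rewrite //= oppr_le0.
have [z1 [y1 [kz1 y10 out1 o1]]] := ih (fun i => c i.+1) (fun i => w i.+1)
  (next (c 0%N) k (w 0%N)) (fun i => ac i.+1) (next_ge0 _ _ _)
  (fun n Nn => w0 n.+1 Nn).
have [z [x [kz E]]] := step_surj (ac 0%N) k0 kz1.
pose y n := if n is n'.+1 then y1 n' else x.
have s1 : orb c y (z, k) 1 = (z1, next (c 0%N) k (w 0%N)).
  by rewrite -[LHS]/((step (c 0%N) k z x).2, next (c 0%N) k (step (c 0%N) k z x).1) E.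
exists z, y; split; first exact: kz.
- by case=> // n; exact: y10.
- case=> [|n]; first by rewrite -[LHS]/((step (c 0%N) k z x).1) E.
  by rewrite out_shift s1; exact: out1.
- by case=> // n; rewrite orb_shift s1; exact: o1.
Qed.

End orbits.

(** * The infinite block *)

Section chain.
Context (R : realType) (m : nat).
Implicit Types (X : 'I_m -> R).

Definition sqr (r : R) : R := r ^+ 2.

Definition srm : R := Num.sqrt m%:R.
(** The coordinate along the unit diagonal vector; [dev] is the squared norm of the orthogonal
    part. *)
Definition comp X : R := (\sum_i X i) / srm.
Definition dev X : R := \sum_i (X i - comp X / srm) ^+ 2.

Definition shift X w : 'I_m -> R := fun i => X i + (w - comp X) / srm.

(* The cosine of the angle used for this copy of [E]: 45 degrees if the off-diagonal
   part [dev X] is small, 90 degrees if it is at least [eta ^+ 2]. *)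
Definition ang (eta : R) X : R :=
  Num.sqrt (1 / 2) * Num.min 1 (Num.max 0 (2 - 2 * dev X / eta ^+ 2)).

Lemma dev_ge0 X : 0 <= dev X.
Proof. by apply: sumr_ge0 => i _; exact: sqr_ge0. Qed.

Lemma half_sqr : 2 * Num.sqrt (1 / 2) ^+ 2 = 1 :> R.
Proof. by rewrite sqr_sqrtr; lra. Qed.

Lemma ang_angle eta X : angle (ang eta X).
Proof.
rewrite /ang; set t := Num.min _ _.
have t0 : 0 <= t by rewrite le_min ler01 le_max lexx.
have t1 : t <= 1 by rewrite ge_min lexx.
split; first by rewrite mulr_ge0 ?sqrtr_ge0.
by rewrite exprMn mulrA half_sqr mul1r expr_le1.
Qed.

Lemma ang_eq0 eta X : 0 < eta -> eta ^+ 2 <= dev X -> ang eta X = 0.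
Proof.
move=> eta0 h; rewrite /ang max_l ?min_r ?mulr0//.
by rewrite subr_le0 ler_pdivlMr ?exprn_gt0// ler_pM2l.
Qed.

Lemma ang_half eta X : 0 < eta -> 2 * dev X <= eta ^+ 2 -> 2 * ang eta X ^+ 2 = 1.
Proof.
move=> eta0 h; rewrite /ang max_r; last first.
  by rewrite subr_ge0 ler_pdivrMr ?exprn_gt0//; have := sqr_ge0 eta; lra.
rewrite min_l ?mulr1 ?half_sqr// lerBrDl -lerBrDr.
by rewrite ler_pdivrMr ?exprn_gt0//; lra.
Qed.

Context (m0 : (0 < m)%N).

Lemma srdim_gt0 : 0 < srm.
Proof. by rewrite sqrtr_gt0 ltr0n. Qed.

Lemma srm_sqr : srm ^+ 2 = m%:R.
Proof. by rewrite sqr_sqrtr. Qed.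

Lemma sum_comp X : \sum_i X i = comp X * srm.
Proof. by rewrite divfK// gt_eqF// srdim_gt0. Qed.

Lemma sum_const (r : R) : \sum_(i < m) r = r * srm ^+ 2.
Proof. by rewrite sumr_const card_ord srm_sqr mulr_natr. Qed.

Lemma sum_sqr X : \sum_i X i ^+ 2 = comp X ^+ 2 + dev X.
Proof.
have s0 : srm != 0 by rewrite gt_eqF// srdim_gt0.
have -> : dev X = \sum_i (X i ^+ 2 +
    (- (2 * (comp X / srm)) * X i + (comp X / srm) ^+ 2)).
  by apply: eq_bigr => i _; ring.
rewrite !big_split/= -mulr_sumr (sum_comp X) sum_const.
by field.
Qed.

Lemma comp_shift X w : comp (shift X w) = w.
Proof.
have s0 : srm != 0 by rewrite gt_eqF// srdim_gt0.
rewrite {1}/comp /shift big_split/= sum_comp sum_const; by field.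
Qed.

Lemma dev_shift X w : dev (shift X w) = dev X.
Proof.
have s0 : srm != 0 by rewrite gt_eqF// srdim_gt0.
apply: eq_bigr => i _; rewrite comp_shift /shift; congr (_ ^+ 2); by field.
Qed.

Lemma shift_shift X w w' : shift (shift X w) w' = shift X w'.
Proof.
have s0 : srm != 0 by rewrite gt_eqF// srdim_gt0.
by apply/funext => i; rewrite /shift comp_shift; field.
Qed.

Lemma shift_comp X : shift X (comp X) = X.
Proof. by apply/funext => i; rewrite /shift subrr mul0r addr0. Qed.

(** The diagonal part contributes at most [srm^-1] to a coordinate, the orthogonal part at most its
    norm. *)
Lemma shift_le eta X w i : 0 < eta -> `|w| <= 1 -> dev X <= eta ^+ 2 ->
  `|shift X w i| <= srm^-1 + eta.
Proof.
move=> eta0 w1 dX; have s0 := srdim_gt0.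
rewrite /shift mulrBl addrCA; apply: le_trans (ler_normD _ _) _; apply: lerD.
  by rewrite normrM (@ger0_norm _ srm^-1) ?invr_ge0 ?(ltW s0)// ler_piMl ?invr_ge0 ?(ltW s0).
rewrite -(ler_pXn2r (ltn0Sn 1)) ?nnegrE ?(ltW eta0)// real_normK ?num_real//.
apply: le_trans dX; rewrite /dev (bigD1 i)//= lerDl sumr_ge0// => j _.
exact: sqr_ge0.
Qed.

End chain.

(** * The mass through partial sums *)

Section totals.
Context (R : realType).

Lemma nneseries_leP (a : nat -> R) (c : R) : (forall n, 0 <= a n) ->
  ((\sum_(n <oo) (a n)%:E)%E <= c%:E)%E <-> forall N, \sum_(n < N) a n <= c.
Proof.
move=> a0; split=> [h N|h].
  rewrite -lee_fin; apply: le_trans h; rewrite -sumEFin -(big_mkord xpredT (fun n => (a n)%:E)).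
  by apply: nneseries_lim_ge => n _; rewrite lee_fin.
apply: lime_le; first by apply: is_cvg_nneseries => n _; rewrite lee_fin.
by apply: nearW => N; rewrite sumEFin lee_fin big_mkord.
Qed.

Lemma tot_nat (phi : R -> R) m (x : nat * 'I_m -> R) : (forall r, 0 <= phi r) ->
  (tot phi x = \sum_(n <oo) (\sum_i phi (x (n, i)))%:E)%E.
Proof.
move=> phi0; rewrite nneseries_esumT; last first.
  by move=> n; rewrite lee_fin sumr_ge0.
rewrite (eq_esum (b := fun n => \esum_(i in [set: 'I_m]) (phi (x (n, i)))%:E)%E); last first.
  by move=> n _; rewrite -(tot_fin (fun i => x (n, i)) phi0).
rewrite esum_esum; last by move=> i j _ _; rewrite lee_fin.
rewrite /tot (_ : _ `*`` _ = setT); last by apply/seteqP; split.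
by apply: eq_esum => -[].
Qed.

Lemma tot_option (phi : R -> R) (T : choiceType) (x : option T -> R) :
  (forall r, 0 <= phi r) ->
  (tot phi x = (phi (x None))%:E + tot phi (fun t => x (Some t)))%E.
Proof.
move=> phi0; rewrite /tot (esumID [set None]); last by move=> i _; rewrite lee_fin.
rewrite setTI esum_set1 ?lee_fin//; congr (_ + _)%E.
apply: reindex_esum; split.
- by move=> t _ /=; split.
- by move=> s t _ _ [].
- by case=> [t|] [_ h] //; case: h.
Qed.

(** Partial sums only give access to real upper bounds of a mass; for finite masses these determine
    it. *)
Lemma tot_eqP (phi : R -> R) (T1 T2 : choiceType) (x : T1 -> R) (y : T2 -> R) :
  (forall r, 0 <= phi r) -> (tot phi x <= 1%:E)%E ->
  (forall c, (tot phi x <= c%:E)%E <-> (tot phi y <= c%:E)%E) ->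
  tot phi y = tot phi x.
Proof.
move=> phi0 x1 xy.
have fin (T : choiceType) (z : T -> R) : (tot phi z <= 1%:E)%E ->
    tot phi z = (fine (tot phi z))%:E.
  move=> z1; rewrite fineK// ge0_fin_numE ?tot_ge0//.
  exact: le_lt_trans z1 (ltry _).
have y1 := (xy 1).1 x1.
apply/le_anti/andP; split.
  by rewrite [leRHS]fin//; apply/xy; rewrite -fin.
by rewrite [leRHS]fin//; apply/xy; rewrite -fin.
Qed.

End totals.

Section chain_block.
Context (R : realType) (m : nat) (m0 : (0 < m)%N) (eta tau : R).
Hypotheses (eta0 : 0 < eta) (tauE : (srm R m)^-1 + eta <= tau).
Local Notation T := (nat * 'I_m)%type.
Implicit Types (x : option T -> R) (y : T -> R).

Definition blk x n : 'I_m -> R := fun i => x (Some (n, i)).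
Definition angs x n : R := ang eta (blk x n).
Definition comps x n : R := comp (blk x n).
Definition outs x : nat -> R := out (angs x) (comps x) (x None, 0).

Definition chain_map (x : {ptws option T -> R}) : {ptws T -> R} :=
  fun p => shift (blk x p.1) (outs x p.1) p.2.

Local Notation lo1 := (fun o : option T => if o is Some _ then - tau else 0).
Local Notation hi1 := (fun o : option T => if o is Some _ then tau else 1).
Local Notation Box1 := (Box (@sqr R) lo1 hi1).
Local Notation Box2 := (Box (@sqr R) (fun=> - tau) (fun=> tau)).

Let sqr0 (r : R) : 0 <= sqr r. Proof. exact: sqr_ge0. Qed.

Definition psum x N : R :=
  x None ^+ 2 + \sum_(n < N) (comps x n ^+ 2 + dev (blk x n)).

Lemma tot_psum x c :
  (tot (@sqr R) x <= c%:E)%E <-> forall N, psum x N <= c.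
Proof.
rewrite tot_option// tot_nat// -leeBrDl// -EFinB.
rewrite nneseries_leP; last by move=> n; apply: sumr_ge0.
have E N : \sum_(n < N) \sum_i sqr (x (Some (nat_of_ord n, i))) =
    \sum_(n < N) (comps x n ^+ 2 + dev (blk x n)).
  by apply: eq_bigr => n _; rewrite -sum_sqr.
by split=> h N; have := h N; rewrite E /psum -lerBrDl.
Qed.

Definition qsum y N : R :=
  \sum_(n < N) (comp (fun i => y (n : nat, i)) ^+ 2 + dev (fun i => y (n : nat, i))).

Lemma tot_qsum y c :
  (tot (@sqr R) y <= c%:E)%E <-> forall N, qsum y N <= c.
Proof.
rewrite tot_nat// nneseries_leP; last by move=> n; apply: sumr_ge0.
have E N : \sum_(n < N) \sum_i sqr (y (nat_of_ord n, i)) = qsum y N.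
  by apply: eq_bigr => n _; rewrite -sum_sqr.
by split=> h N; have := h N; rewrite E.
Qed.

Lemma angs_angle x n : angle (angs x n). Proof. exact: ang_angle. Qed.

Lemma psum_bound x N : (tot (@sqr R) x <= 1%:E)%E ->
  x None ^+ 2 + \sum_(n < N) comps x n ^+ 2 <= 1.
Proof.
move=> /tot_psum/(_ N); apply: le_trans; rewrite /psum big_split/= addrA lerDl.
by apply: sumr_ge0 => i _; exact: dev_ge0.
Qed.

Lemma angs_half x : (tot (@sqr R) x <= 1%:E)%E -> half_eventually (angs x).
Proof.
move=> /tot_psum x1.
have : vanishing (fun n => Num.sqrt (dev (blk x n))).
  apply: (@vanishing_summable _ _ 1) => n; apply: le_trans (x1 n).
  rewrite /psum big_split/= addrA.
  under eq_bigr do rewrite sqr_sqrtr ?dev_ge0//.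
  by rewrite lerDr addr_ge0 ?sqr_ge0 ?sumr_ge0// => i _; exact: sqr_ge0.
move=> /(_ (eta / 2))[|N hN]; first by rewrite divr_gt0.
exists N => n Nn; apply: ang_half => //.
have := hN n Nn; rewrite ger0_norm ?sqrtr_ge0// => h.
have : Num.sqrt (dev (blk x n)) ^+ 2 <= (eta / 2) ^+ 2.
  by rewrite ler_pXn2r ?nnegrE ?sqrtr_ge0// divr_ge0// ltW.
rewrite sqr_sqrtr ?dev_ge0//; have := sqr_ge0 eta; lra.
Qed.

Lemma chain_comp x n : comp (fun i => chain_map x (n, i)) = outs x n.
Proof. by rewrite -[LHS]/(comp (shift (blk x n) (outs x n))) comp_shift. Qed.

Lemma chain_dev x n : dev (fun i => chain_map x (n, i)) = dev (blk x n).
Proof. by rewrite -[LHS]/(dev (shift (blk x n) (outs x n))) dev_shift. Qed.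

Lemma chain_qsum x N : 0 <= x None ->
  qsum (chain_map x) N + (orb (angs x) (comps x) (x None, 0) N).1 ^+ 2 = psum x N.
Proof.
move=> x0; rewrite /qsum /psum !big_split/= addrAC addrA.
rewrite -(@orb_energy _ (angs x) (comps x) (x None, 0) N)//=; last 2 first.
- by move=> i; exact: angs_angle.
- by rewrite oppr0.
congr (_ + _ + _).
  by apply: eq_bigr => n _; rewrite chain_comp.
by apply: eq_bigr => n _; rewrite chain_dev.
Qed.

(** At each stage the mass still missing is the squared carry, by [chain_qsum], and the carry
    vanishes. *)
Lemma chain_tot x : (tot (@sqr R) x <= 1%:E)%E -> 0 <= x None ->
  tot (@sqr R) (chain_map x) = tot (@sqr R) x.
Proof.
move=> x1 x0; apply: tot_eqP => // c; rewrite tot_psum tot_qsum; split=> h N.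
  by apply: le_trans (h N); rewrite -chain_qsum// lerDl sqr_ge0.
apply/ler_addgt0Pr => r r0.
have sr0 : 0 < Num.sqrt r by rewrite sqrtr_gt0.
have kz : - 0 <= x None by rewrite oppr0.
have [M hM] := @orb_vanishing _ _ _ (x None) 0 (@angs_angle x) (angs_half x1)
  (lexx 0) kz (fun N => psum_bound N x1) _ sr0.
apply: (@le_trans _ _ (psum x (maxn N M))).
  rewrite /psum lerD2l -!(big_mkord xpredT (fun n => comps x n ^+ 2 + dev (blk x n))).
  rewrite [leRHS](@big_cat_nat _ _ _ N)//= ?leq_maxl// lerDl sumr_ge0// => n _.
  by rewrite addr_ge0 ?sqr_ge0 ?dev_ge0.
rewrite -chain_qsum//; apply: lerD; first exact: h.
have hNM := hM _ (leq_maxr N M).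
rewrite -[leRHS](sqr_sqrtr (ltW r0)) -[leLHS]real_normK ?num_real//.
by rewrite ler_pXn2r ?nnegrE ?sqrtr_ge0.
Qed.

Lemma out_swap (c v : nat -> R) (z : R) n : (forall i, angle (c i)) -> 0 <= z ->
  c n = 0 -> out c v (z, 0) n = v n.
Proof.
move=> ac z0 cn; have kz : - 0 <= z by rewrite oppr0.
have [k1 z1] := @orb_inv _ c v (z, 0) n ac (lexx 0) kz.
by rewrite /out cn step_swap.
Qed.

(** Where the orthogonal part is large the angle is 90 degrees and nothing changes; elsewhere
    [shift_le] applies. *)
Lemma shift_bound (X : 'I_m -> R) w i : (forall j, `|X j| <= tau) -> `|w| <= 1 ->
  (ang eta X = 0 -> w = comp X) -> `|shift X w i| <= tau.
Proof.
move=> Xt w1 h; have [dX|dX] := leP (eta ^+ 2) (dev X).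
  by rewrite h ?shift_comp// ang_eq0.
by apply: le_trans tauE; apply: shift_le => //; exact: ltW.
Qed.

Lemma sqr_le1 (r : R) : r ^+ 2 <= 1 -> `|r| <= 1.
Proof.
by move=> h; rewrite -(ler_pXn2r (ltn0Sn 1)) ?nnegrE// expr1n real_normK ?num_real.
Qed.

Lemma chain_box x : Box1 x -> Box2 (chain_map x).
Proof.
move=> [x1 bx]; have x0 : 0 <= x None by case/andP: (bx None).
split; first by rewrite chain_tot.
move=> [n i]; rewrite -ler_norml; apply: shift_bound.
- by move=> j; have := bx (Some (n, j)); rewrite /= -ler_norml.
- have /tot_qsum/(_ n.+1) : (tot (@sqr R) (chain_map x) <= 1%:E)%E by rewrite chain_tot.
  rewrite /qsum big_ord_recr/= chain_comp => h; apply: sqr_le1; apply: le_trans h.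
  rewrite addrA [_ + outs x n ^+ 2]addrC -addrA lerDl addr_ge0 ?dev_ge0 ?sumr_ge0// => j _.
  by rewrite addr_ge0 ?sqr_ge0 ?dev_ge0.
- by move=> a0; exact: out_swap (angs_angle x) x0 a0.
Qed.

(** Orthogonal parts are untouched, so the image determines the angles, and [orb_inj] then recovers
    the initial carry and the diagonal components. *)
Lemma chain_inj x x' : Box1 x -> Box1 x' -> chain_map x = chain_map x' -> x = x'.
Proof.
move=> [x1 bx] [x1' bx'] E.
have x0 : - 0 <= x None by rewrite oppr0; case/andP: (bx None).
have x0' : - 0 <= x' None by rewrite oppr0; case/andP: (bx' None).
have devE n : dev (blk x n) = dev (blk x' n) by rewrite -!chain_dev E.
have angE : angs x' = angs x by apply/funext => n; rewrite /angs /ang devE.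
have outE n : outs x n = outs x' n by rewrite -!chain_comp E.
have [] := @orb_inj _ (angs x) (comps x) (comps x') (x None) (x' None) 0
  (angs_angle x) (angs_half x1) (lexx 0) x0 (fun N => psum_bound N x1)
  x0' (fun N => psum_bound N x1').
  by move=> n; have := outE n; rewrite /outs angE.
move=> E0 Ec; apply/funext => -[[n i]|//].
have : shift (fun i => chain_map x (n, i)) (comps x n) i =
       shift (fun i => chain_map x' (n, i)) (comps x' n) i by rewrite E Ec.
by rewrite /chain_map /= !shift_shift// !shift_comp.
Qed.

Lemma chain_continuous : continuous chain_map.
Proof.
apply: ptws_continuous => -[n i] x; rewrite /chain_map /shift /=.
have ec (o : option T) : continuous_at x (fun x : {ptws option T -> R} => x o).
  exact: eval_continuous.
have cc k : continuous_at x (fun x : {ptws option T -> R} => comps x k).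
  apply: contM; last exact: cont_cst.
  by apply: cont_sum => j; exact: ec.
have ac k : continuous_at x (fun x : {ptws option T -> R} => angs x k).
  have dc : continuous_at x (fun x : {ptws option T -> R} => dev (blk x k)).
    apply: cont_sum => j; apply: contX; apply: contD; first exact: ec.
    by apply: contN; apply: contM; [exact: cc|exact: cont_cst].
  apply: contM; first exact: cont_cst.
  apply: cont_min; first exact: cont_cst.
  apply: cont_max; first exact: cont_cst.
  apply: contD; first exact: cont_cst.
  apply: contN; apply: contM; last exact: cont_cst.
  by apply: contM => //; exact: cont_cst.
have oc k : continuous_at x (fun x : {ptws option T -> R} =>
      (orb (angs x) (comps x) (x None, 0) k).1) /\
    continuous_at x (fun x : {ptws option T -> R} =>
      (orb (angs x) (comps x) (x None, 0) k).2).
  elim: k => [|k [ih1 ih2]]; first by split; [exact: ec|exact: cont_cst].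
  have [s1 s2] := cont_step (ac k) ih2 ih1 (cc k).
  split; first exact: s2.
  apply: (cont_next _ (ac k) ih2 s1); rewrite gt_eqF//.
  by have [] := angleP (angs_angle x k).
have [q1 q2] := oc n; have [s1 _] := cont_step (ac n) q2 q1 (cc n).
apply: contD; first exact: ec.
apply: contM; last exact: cont_cst.
by apply: contD; [exact: s1|apply: contN; exact: cc].
Qed.

(* Sequences supported in finitely many copies of [E] are reached by running the
   steps backwards from a zero carry; compactness gives the others. *)
Lemma chain_surj_finite y N : Box2 y ->
  (forall n i, (N <= n)%N -> y (n, i) = 0) ->
  exists2 x, Box1 x & chain_map x = y.
Proof.
move=> [y1 by_] yN; pose yb n i : R := y (n : nat, i).
pose c n := ang eta (yb n); pose w n := comp (yb n).
have ac n : angle (c n) by exact: ang_angle.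
have w0 n : (N <= n)%N -> w n = 0.
  by move=> Nn; rewrite /w /comp big1 ?mul0r// => i _; exact: yN.
have [z [v [kz v0 outE oz]]] := orb_surj ac (lexx 0) w0.
rewrite oppr0 in kz.
pose x (o : option T) := if o is Some p then shift (yb p.1) (v p.1) p.2 else z.
have bE n : blk x n = shift (yb n) (v n) by [].
have cE : comps x = v by apply/funext => n; rewrite /comps bE comp_shift.
have aE : angs x = c by apply/funext => n; rewrite /angs bE /ang dev_shift.
have oE : outs x = w by apply/funext => n; rewrite /outs aE cE /=; exact: outE.
have xy : chain_map x = y.
  apply/funext => -[n i]; rewrite /chain_map oE bE shift_shift//.
  by rewrite shift_comp.
have x1 : (tot (@sqr R) x <= 1%:E)%E.
  apply/tot_psum => M.
  have : psum x (maxn M N) <= 1.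
    rewrite -chain_qsum// aE cE /= oz ?leq_maxr// expr0n addr0 xy.
    exact: (tot_qsum _ _).1.
  apply: le_trans.
  rewrite /psum lerD2l -!(big_mkord xpredT (fun n => comps x n ^+ 2 + dev (blk x n))).
  rewrite [leRHS](@big_cat_nat _ _ _ M)//= ?leq_maxl// lerDl sumr_ge0// => n _.
  by rewrite addr_ge0 ?sqr_ge0 ?dev_ge0.
have zle : `|z| <= 1.
  by apply: sqr_le1; have := psum_bound 0 x1; rewrite big_ord0 addr0.
exists x => //; split=> //; case=> [[n i]|] /=; last first.
  by rewrite kz /= -(ger0_norm kz).
rewrite -ler_norml; apply: shift_bound.
- by move=> j; rewrite ler_norml; exact: by_.
- apply: sqr_le1; apply: le_trans (psum_bound n.+1 x1).
  rewrite big_ord_recr/= cE addrA lerDr addr_ge0 ?sqr_ge0 ?sumr_ge0// => j _.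
  exact: sqr_ge0.
- by move=> a0; rewrite -(out_swap v ac kz a0) outE.
Qed.

Lemma chain_tot_iso : tot_iso (@sqr R) lo1 hi1 (fun=> - tau) (fun=> tau) chain_map.
Proof.
have sqrc : continuous (@sqr R) by move=> r; apply: contX; exact: cvg_id.
split; [exact: chain_continuous| |].
- split; [exact: chain_box| |].
  + by move=> x x' /set_mem bx /set_mem bx'; exact: chain_inj.
  (* The truncations [yt N] are attained and converge pointwise to [y], and the image of the compact
     box is closed. *)
  + move=> y yB; pose yt N : {ptws T -> R} := fun p => if (p.1 < N)%N then y p else 0.
    have cl : closed (chain_map @` Box1).
      apply: compact_closed; first exact: hausdorff_ptws.
      apply: continuous_compact; first exact/continuous_subspaceT/chain_continuous.
      exact: compact_Box.
    have yt_im N : (chain_map @` Box1) (yt N).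
      have [||x xB xy] := @chain_surj_finite (yt N) N; last by exists x.
        case: yB => y1 by_; split.
          apply: le_trans y1; apply: le_esum => p _; rewrite lee_fin /yt.
          by case: ifP => // _; rewrite /sqr expr0n sqr_ge0.
        move=> p; rewrite /yt; case: ifP => _; first exact: by_.
        by have := by_ p; rewrite -!ler_norml normr0; exact: le_trans.
      by move=> n i Nn; rewrite /yt /= ltnNge Nn.
    have yty : yt N @[N --> \oo] --> (y : {ptws T -> R}).
      apply: ptws_cvg => p; apply: cvg_near_cst.
      by exists p.1.+1 => // N /= pN; rewrite /yt pN.
    have [x xB xy] : (chain_map @` Box1) y.
      by apply: (closed_cvg _ cl _ _ yty); apply: nearW.
    by exists x.
- move=> x [x1 bx]; apply: chain_tot => //; by case/andP: (bx None).
Qed.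

End chain_block.

(** * Homeomorphisms between boxes *)

Section assembly.
Context (R : realType).

(** Leads from the coordinates with quadratic mass back to the original ones. *)
Definition ssq (r : R) : R := r * `|r|.

Lemma ssq_norm r : `|ssq r| = sqr r.
Proof. by rewrite /ssq /sqr normrM normr_id -expr2 real_normK ?num_real. Qed.

Lemma ler_ssq : {mono ssq : a b / a <= b}.
Proof.
apply: le_mono => a b; rewrite /ssq.
have [a0|a0] := leP 0 a; have [b0|b0] := leP 0 b => ab.
- by rewrite !ger0_norm//; nra.
- by lra.
- rewrite (ltr0_norm a0) (ger0_norm b0).
  have : 0 < a * a by nra.
  by have := mulr_ge0 b0 b0; lra.
- by rewrite !ltr0_norm//; nra.
Qed.

Lemma ssq_surj r : exists r', ssq r' = r.
Proof.
exists (Num.sg r * Num.sqrt `|r|).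
rewrite /ssq normrM (ger0_norm (sqrtr_ge0 _)) mulrACA -expr2 sqr_sqrtr//.
have [->|r0] := eqVneq r 0; first by rewrite normr0 mulr0.
by rewrite normr_sg r0 mulr1 -numEsg.
Qed.

Lemma ssq_homeomorphic (J : choiceType) (lo hi : J -> R) :
  homeomorphic (set_type (Box (@sqr R) lo hi))
    (set_type (Box Num.norm (ssq \o lo) (ssq \o hi))).
Proof.
have totE (x : J -> R) : tot Num.norm (ssq \o x) = tot (@sqr R) x.
  by apply: eq_esum => j _; rewrite /= ssq_norm.
apply: (@homeomorphic_set_bij {ptws J -> R} {ptws J -> R} _ _
  (fun x : {ptws J -> R} => (ssq \o x : {ptws J -> R}))).
- exact: hausdorff_ptws.
- by apply: compact_Box => r; apply: contX; exact: cvg_id.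
- apply: ptws_continuous => j x; apply: contM; last apply: cont_norm;
    exact: eval_continuous.
- split.
  + by move=> x [x1 bx]; split=> [|j]; rewrite ?totE//= !ler_ssq.
  + move=> x y _ _ /funeqP xy; apply/funext => j.
    by apply: (inc_inj ler_ssq); exact: xy.
  + move=> y [y1 by_]; have /choice[x xP] := fun j => ssq_surj (y j).
    have yE : y = ssq \o x by apply/funext => j; rewrite /= xP.
    exists x => //; split; first by rewrite -totE -yE.
    by move=> j; have := by_ j; rewrite yE /= !ler_ssq.
Qed.

Lemma reindex_homeomorphic (J1 J2 : choiceType) (e : J1 -> J2) (lo hi : J2 -> R) :
  bijective e ->
  homeomorphic (set_type (Box Num.norm lo hi))
    (set_type (Box Num.norm (lo \o e) (hi \o e))).
Proof.
by move=> /(reindex_tot_iso Num.norm lo hi)/tot_iso_homeomorphic; apply;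
  exact: norm_continuous.
Qed.

Section chain_boxes.
Context (t : R) (t0 : 0 < t) (m : nat) (mt : 1 < m%:R * t).
Local Notation T := (nat * 'I_m)%type.

Lemma dim_gt0 : (0 < m)%N.
Proof. by rewrite lt0n; apply/negP => /eqP E; move: mt; rewrite E mul0r ltr10. Qed.

Lemma chain_homeomorphic (D I : choiceType) :
  homeomorphic
    (set_type (Box Num.norm
      (glue (fun _ : D => - t)
        (fun (_ : I) (o : option T) => if o is Some _ then - t else 0))
      (glue (fun=> t) (fun _ (o : option T) => if o is Some _ then t else 1))))
    (set_type (Box Num.norm (fun _ : D + I * T => - t) (fun=> t))).
Proof.
(* [tau] is the bound [t] in the quadratic coordinates; [1 < m%:R * t] amounts to
   [(srm R m)^-1 < tau], which leaves room for [eta]. *)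
have m0 := dim_gt0; pose tau := Num.sqrt t; pose eta := tau - (srm R m)^-1.
have tau0 : 0 < tau by rewrite sqrtr_gt0.
have eta0 : 0 < eta.
  have mr0 : 0 < m%:R :> R by rewrite ltr0n.
  have sm0 := srdim_gt0 R m0.
  rewrite subr_gt0 -(ltr_pXn2r (ltn0Sn 1)) ?nnegrE ?invr_ge0 ?(ltW sm0) ?(ltW tau0)//.
  by rewrite exprVn srm_sqr sqr_sqrtr ?(ltW t0)// -(ltr_pM2l mr0) divff ?gt_eqF.
have tauE : (srm R m)^-1 + eta <= tau by rewrite /eta addrC subrK.
have iso := block_tot_iso (D := D) I (fun=> sqr_ge0 _) (fun=> - tau) (fun=> tau)
  (chain_tot_iso m0 eta0 tauE).
have sqc : continuous (@sqr R) by move=> r; apply: contX; exact: cvg_id.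
have h := tot_iso_homeomorphic sqc iso.
have st : ssq tau = t by rewrite /ssq ger0_norm ?sqrtr_ge0// -expr2 sqr_sqrtr ?ltW.
have sNt : ssq (- tau) = - t by rewrite /ssq normrN mulNr -/(ssq tau) st.
have s0 : ssq 0 = 0 by rewrite /ssq mul0r.
have s1 : ssq 1 = 1 by rewrite /ssq normr1 mulr1.
apply: homeomorphic_trans (homeomorphic_trans _ h) _.
  apply: homeomorphic_sym.
  set W := Box Num.norm _ _.
  rewrite (_ : W = Box Num.norm
     (ssq \o glue (fun _ : D => - tau)
       (fun (_ : I) (o : option T) => if o is Some _ then - tau else 0))
     (ssq \o glue (fun=> tau)
       (fun _ (o : option T) => if o is Some _ then tau else 1))).
    exact: ssq_homeomorphic.
  by congr Box; apply/funext => -[d|[i [p|]]] /=.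
set W := Box Num.norm _ _.
have -> : W = Box Num.norm
    (ssq \o glue (fun _ : D => - tau) (fun (_ : I) (_ : T) => - tau))
    (ssq \o glue (fun _ : D => tau) (fun (_ : I) (_ : T) => tau)).
  by congr Box; apply/funext => -[d|[i p]] /=.
exact: ssq_homeomorphic.
Qed.

End chain_boxes.

Lemma const_homeomorphic (J K : choiceType) (i : J -> K * nat) (j : K -> J)
    (a b : R) : infinite_set [set: K] -> injective i -> injective j ->
  homeomorphic (set_type (Box Num.norm (fun _ : J => a) (fun=> b)))
    (set_type (Box Num.norm (fun _ : K => a) (fun=> b))).
Proof.
move=> infK ii ji; have [f bf] := infinite_bij infK ii ji.
exact: (reindex_homeomorphic (fun=> a) (fun=> b) bf).
Qed.

Lemma pair_homeomorphic (t : R) (D I : choiceType) : 0 < t -> t <= 1 ->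
  homeomorphic
    (set_type (Box Num.norm
      (glue (fun _ : D => 0 : R) (fun (_ : I) (b : bool) => if b then - t else 0))
      (glue (fun=> 1) (fun _ (b : bool) => if b then t else 1))))
    (set_type (Box Num.norm (fun _ : D + I * bool => 0 : R) (fun=> 1))).
Proof.
move=> t0 t1.
have := block_tot_iso (D := D) I (fun r : R => normr_ge0 r) (fun=> 0) (fun=> 1)
  (pair_tot_iso t0 t1).
move=> /tot_iso_homeomorphic h; have {}h := h (@norm_continuous _ _).
set W := Box Num.norm (fun _ : D + I * bool => 0 : R) _.
suff -> : W = Box Num.norm (glue (fun _ : D => 0 : R) (fun (_ : I) (_ : bool) => 0))
  (glue (fun _ : D => 1 : R) (fun (_ : I) (_ : bool) => 1)) by exact: h.
by congr Box; apply/funext => -[d|[i b]].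
Qed.

Lemma simplex_homeomorphic (t : R) (m : nat) (D I : choiceType) : 0 < t ->
  1 < m%:R * t ->
  homeomorphic
    (set_type (Box Num.norm (fun _ : void + I * 'I_m => 0 : R) (fun=> 1)))
    (set_type (Box Num.norm (fun _ : void + I * 'I_m => 0 : R) (fun=> t))).
Proof.
move=> t0 mt; have m0 := dim_gt0 mt.
have := block_tot_iso (D := void) I (fun r : R => normr_ge0 r) (fun=> 0)
  (fun=> 0) (radial_tot_iso m0 t0 mt).
move=> /tot_iso_homeomorphic h; have {}h := h (@norm_continuous _ _).
set W1 := Box _ _ _; set W2 := Box _ _ _.
have -> : W1 = Box Num.norm (glue (fun _ : void => 0 : R) (fun (_ : I) (_ : 'I_m) => 0))
    (glue (fun _ : void => 0 : R) (fun (_ : I) (_ : 'I_m) => 1)).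
  by congr Box; apply/funext => -[[]|[i b]].
have -> : W2 = Box Num.norm (glue (fun _ : void => 0 : R) (fun (_ : I) (_ : 'I_m) => 0))
    (glue (fun _ : void => 0 : R) (fun (_ : I) (_ : 'I_m) => t)).
  by congr Box; apply/funext => -[[]|[i b]].
exact: h.
Qed.

Section infinite.
Context (K : choiceType) (infK : infinite_set [set: K]).
Let PK := set_type (Box Num.norm (fun _ : K => 0 : R) (fun=> 1)).

Lemma exists_bound (t : R) : 0 < t -> exists m : nat, 1 < m%:R * t.
Proof.
move=> t0; exists (Num.bound (1 / t)); rewrite -ltr_pdivrMr//.
by apply: archi_boundP; rewrite divr_ge0// ltW.
Qed.

Lemma inr_pickle_inj (C : countType) :
  injective (fun p : void + K * C => match p with
    | inl v => match v return K * nat with end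
    | inr (k, c) => (k, pickle c) end).
Proof. by move=> [[]|[k c]] [[]|[l d]] /= [-> /(pcan_inj pickleK) ->]. Qed.

Lemma box_nonneg_homeomorphic (t : R) : 0 < t ->
  homeomorphic (set_type (Box Num.norm (fun _ : K => 0) (fun=> t))) PK.
Proof.
move=> t0; have [m mt] := exists_bound t0; have m0 := dim_gt0 mt.
pose j k : void + K * 'I_m := inr (k, Ordinal m0).
have ji : injective j by move=> k l [].
apply: homeomorphic_trans (homeomorphic_sym _) (homeomorphic_trans
  (homeomorphic_sym (simplex_homeomorphic void K t0 mt)) _);
  exact: const_homeomorphic infK (@inr_pickle_inj _) ji.
Qed.

Lemma box_sym_homeomorphic (t : R) : 0 < t -> t <= 1 ->
  homeomorphic (set_type (Box Num.norm (fun _ : K => - t) (fun=> t))) PK.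
Proof.
move=> t0 t1; have [m mt] := exists_bound t0; have m0 := dim_gt0 mt.
pose T := (nat * 'I_m)%type.
have [g [g' gg' g'g]] : exists g : K -> void + K * T, bijective g.
  apply: (@infinite_bij _ _ _ (fun k => inr (k, (0%N, Ordinal m0))) infK (@inr_pickle_inj _)).
  by move=> k l [].
(* The coordinate in [0, 1] of block [k] is matched with [(k, false)]; through [g], all other
   coordinates of all blocks are distributed among the [(k, true)]. *)
pose e (p : void + K * bool) : void + K * option T := match p with
  | inl v => match v with end
  | inr (k, false) => inr (k, None)
  | inr (k, true) => match g k with
      inl v => match v with end
    | inr (l, q) => inr (l, Some q) end end.
pose e' (p : void + K * option T) : void + K * bool := match p with
  | inl v => match v with end
  | inr (k, None) => inr (k, false)
  | inr (k, Some q) => inr (g' (inr (k, q)), true) end.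
have be : bijective e.
  exists e'.
  - move=> [[]|[k []]] //=; case E : (g k) => [[]|[l q]] /=.
    by rewrite -E gg'.
  - by move=> [[]|[k [q|]]] //=; rewrite g'g.
have h1 := chain_homeomorphic t0 mt void K.
have h2 := const_homeomorphic (- t) t infK (@inr_pickle_inj _)
  (_ : injective (fun k => inr (k, (0%N, Ordinal m0)) : void + K * T)).
apply: homeomorphic_trans (homeomorphic_sym (homeomorphic_trans h1 (h2 _))) _.
  by move=> k l [].
apply: homeomorphic_trans (reindex_homeomorphic _ _ be) _.
set W := Box _ _ _.
have -> : W = Box Num.norm
      (glue (fun _ : void => 0 : R) (fun (_ : K) (b : bool) => if b then - t else 0))
      (glue (fun=> 1) (fun _ (b : bool) => if b then t else 1)).
  by congr Box; apply/funext => -[[]|[k []]] //=; case: (g k) => [[]|[l q]].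
apply: homeomorphic_trans (pair_homeomorphic void K t0 t1) _.
apply: const_homeomorphic infK (@inr_pickle_inj _) (_ : injective (fun k => inr (k, true))).
by move=> k l [].
Qed.

Lemma box_half_homeomorphic (i0 : K) :
  homeomorphic
    (set_type (Box Num.norm (fun i => if i == i0 then 0 else - 1 : R) (fun=> 1)))
    (set_type (Box Num.norm (fun _ : K => - 1 : R) (fun=> 1))).
Proof.
have [m mt] := exists_bound (ltr01 : (0 : R) < 1); have m0 := dim_gt0 mt.
pose T := (nat * 'I_m)%type.
(* The block occupies positions from 1 on over [i0], since [inl i0] takes position 0. *)
pose i (C : countType) (p : K + unit * C) : K * nat := match p with
  inl k => (k, 0%N) | inr (_, c) => (i0, (pickle c).+1) end.
have ii C : injective (i C).
  by move=> [k|[[] c]] [l|[[] d]] //= []; [move=> ->|move=> /(pcan_inj pickleK) ->].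
have [f [f' ff' f'f]] : exists f : K -> K + unit * option T, bijective f.
  by apply: (infinite_bij infK (ii _) (_ : injective inl)) => k l [].
(* A transposition makes [i0] correspond to the nonnegative coordinate of the block. *)
pose j0 := f' (inr (tt, None)).
pose tr k := if k == i0 then j0 else if k == j0 then i0 else k.
have trK : involutive tr.
  move=> k; rewrite /tr; have [->|ki] := eqVneq k i0.
    by have [->//|_] := eqVneq j0 i0; rewrite eqxx.
  by have [->|kj] := eqVneq k j0; [rewrite eqxx|rewrite (negbTE ki) (negbTE kj)].
have be : bijective (f \o tr).
  by exists (tr \o f'); [exact: can_comp|exact: can_comp].
have fi0 : (f \o tr) i0 = inr (tt, None) by rewrite /= /tr eqxx f'f.
have h := reindex_homeomorphic
      (glue (fun _ : K => - 1 : R)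
        (fun (_ : unit) (o : option T) => if o is Some _ then - 1 else 0))
      (glue (fun=> 1) (fun _ (o : option T) => if o is Some _ then 1 else 1)) be.
set W := Box _ _ _.
have -> : W = Box Num.norm
      (glue (fun _ : K => - 1 : R)
        (fun (_ : unit) (o : option T) => if o is Some _ then - 1 else 0)
          \o (f \o tr))
      (glue (fun=> 1) (fun _ (o : option T) => if o is Some _ then 1 else 1)
          \o (f \o tr)).
  congr Box; apply/funext => k; last first.
    by rewrite /=; case: (f (tr k)) => [l|[[] [q|]]].
  have [->|ki] := eqVneq k i0; first by rewrite /comp; have /= -> := fi0.
  case E : ((f \o tr) k) => [l|[[] [q|]]]; rewrite /= /= in E *; rewrite ?E//.
  by move: ki; rewrite (bij_inj be (etrans E (esym fi0))) eqxx.
apply: homeomorphic_trans (homeomorphic_sym h) _.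
apply: homeomorphic_trans (chain_homeomorphic ltr01 mt K unit) _.
by apply: const_homeomorphic infK (ii _) (_ : injective inl) => k l [].
Qed.

End infinite.
End assembly.

(** * The five spaces *)

Unset Implicit Arguments.

Theorem corollary1 (R : realType) (K : choiceType)
    (K_uncountable : ~ countable [set: K]) (i0 : K)
    (t : R) (t_gt0 : 0 < t) (t_lt1 : t < 1) :
  let spaces : set (set {ptws K -> R}) :=
    [set @Bfull R K; @Bplus R K; @Bhalf R K i0;
         Bbox (fun=> - t) (fun=> t); Bbox (fun=> 0) (fun=> t)] in
  (forall X, spaces X -> compact X) /\
  (forall X Y, spaces X -> spaces Y ->
     homeomorphic (set_type X) (set_type Y)).
Proof.
move=> spaces.
have infK : infinite_set [set: K].
  by move=> /finite_set_countable.
have fullE : @Bfull R K = Box Num.norm (fun=> -1) (fun=> 1).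
  by apply/seteqP; split=> x [].
have plusE : @Bplus R K = Box Num.norm (fun=> 0) (fun=> 1).
  apply/seteqP; split=> x; first by move=> [[_ ?] ?].
  move=> [x1 bx]; split=> //; split=> // i; have := bx i; lra.
have cb (lo hi : K -> R) : compact (Box Num.norm lo hi).
  exact/compact_Box/norm_continuous.
have full := box_sym_homeomorphic infK (@ltr01 R) (lexx 1).
(* Every space is compared with the positive ball. The full ball is the symmetric box for [t = 1],
   and the half ball is first taken to the full ball. *)
have base X : spaces X ->
    homeomorphic (set_type X) (set_type (Box Num.norm (fun _ : K => 0 : R) (fun=> 1))).
  case=> [[[[->|->]|->]|->]|->].
  - by rewrite fullE; exact: full.
  - by rewrite plusE; exact: homeomorphic_refl.
  - exact: homeomorphic_trans (box_half_homeomorphic R infK i0) full.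
  - exact (box_sym_homeomorphic infK t_gt0 (ltW t_lt1)).
  - exact (box_nonneg_homeomorphic infK t_gt0).
split.
- by move=> X [[[[->|->]|->]|->]|->]; rewrite ?fullE ?plusE; exact: cb.
- by move=> X Y /base hX /base hY; exact: homeomorphic_trans hX (homeomorphic_sym hY).
Qed.
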